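(* Let $\mathcal A_0^N=(A^N_{0,i})_{i\in\mathcal I_0}$ and $\mathcal A_1^N=(A^N_{1,i})_{i\in\mathcal I_1}$ be two finite deterministic families of tensors, $A^N_{\epsilon,i}\in\mathcal E^N_{\ell_\epsilon(i)}$ for $i\in\mathcal I_\epsilon$, $\epsilon\in\{0,1\}$, with finite disjoint index sets $\mathcal I_\epsilon$ and orders $\ell_\epsilon$ not depending on $N$, each satisfying (A1): for each $\epsilon\in\{0,1\}$ and every $\mathfrak n\in\mathcal M_0(\mathcal I_\epsilon)$, $\sup_N|\mathfrak n(\mathcal A^N_\epsilon)|<\infty$. Let $U_N$ be Haar distributed on $\mathrm O(N)$, $\tilde{\mathcal A}_1^N=\mathcal A_1^N\cdot U_N^{\#}$, $\mathcal I=\mathcal I_0\sqcup\mathcal I_1$, $\mathcal A^N=\mathcal A^N_0\sqcup\tilde{\mathcal A}^N_1$ and $\mathbb E_N[\mathfrak n]=\mathbb E[\mathfrak n(\mathcal A^N)]$. Let $\mathfrak m=(\pi,\alpha,w)\in\mathcal M_0(\mathcal I)$ be connected and let $e\in\vec E(\mathfrak m)$ be such that $w_e\in\mathcal I_1$ and $w_{\alpha(e)}\notin\mathcal I_1$. Then, as $N\to\infty$, $$\mathbb E_N[\mathfrak m]=\sum_f\mathbb E_N[\mathfrak m^+_{e,f}]-\sum_f\mathbb E_N[\mathfrak m^-_{e,f}]+O\Big(\frac1N\Big),$$ where the sums are over all $f\neq e$ in $\vec E(\mathfrak m)$ such that $w_f\in\mathcal I_1$, $w_{\alpha(f)}\notin\mathcal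 I_1$ and $\mathfrak m^{\pm}_{e,f}<\mathfrak m$ has two connected components (with sign $+$ in the first sum and $-$ in the second). In the first sum, $\mathfrak m_{e,f}^+$ is obtained from $\mathfrak m$ by the switch which matches $e$ with $f$ and $\alpha(e)$ with $\alpha(f)$. In the second sum, $\mathfrak m^-_{e,f}$ is obtained from $\mathfrak m$ by the switch which matches $e$ with $\alpha(f)$ and $\alpha(e)$ with $f$.
   Context: Rotated families. For $T\in\mathcal E^N_p$ and $U\in\mathcal E^N_2$, $T\cdot U^p\in\mathcal E^N_p$ is $(T\cdot U^p)_j=\sum_{i\in[N]^p}T_i\prod_{k=1}^pU_{j_ki_k}$. $\mathcal A_1^N\cdot U_N^{\#}$ is the family $(A_{1,i}^N\cdot U_N^{\ell_1(i)})_{i\in\mathcal I_1}$. Maps. $[n]=\{1,\dots,n\}$. A (combinatorial) map is a pair $\mathfrak m=(\pi,\alpha)$ of permutations of a set $\vec E(\mathfrak m)=[m]$ of half-edges, $\alpha$ an involution ($\alpha^2=\mathrm{id}$, fixed points allowed). The cycles of $\pi$ are the vertices, forming $V(\mathfrak m)$ and ordered by least element; $\partial v$ is the cycle of $v$ started at its least element (the half-edges attached to $v$), and $\deg(v)$ its length. Fixed points of $\alpha$ are the boundary edges; the 2-cycles of $\alpha$ are the edges. $E(\mathfrak m)$ is the set of all cycles of $\alpha$. $\mathcal M_q$ is the set of maps with $q$ boundary edges. An $I$-map (for an index set $I$ with order function $\ell$) is a map with labels $w_v\in I$, $\ell(w_v)=\deg(v)$, written $(\pi,\alpha,w)$; $\mathcal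 M_q(I)$ is the set of $I$-maps with $q$ boundary edges. For a half-edge $e$ attached to $v$, $w_e=w_v$. Trace action. $\mathcal E^N_p=(\mathbb C^N)^{\otimes p}$. For $\mathfrak m\in\mathcal M_0(I)$ with $\gamma$ connected components and a family $\mathcal A^N=(A_i^N)_{i\in I}$, $A_i^N\in\mathcal E^N_{\ell(i)}$, $\mathfrak m(\mathcal A^N)=N^{-\gamma}\sum_{i\in[N]^{E(\mathfrak m)}}\prod_v(A^N_{w_v})_{i_{\partial v}}\in\mathbb C$, where $i_{\partial v}$ is the tuple of indices of the edges containing the half-edges of $\partial v$. Poset. Maps $(\pi,\alpha),(\pi,\alpha')\in\mathcal M_0$ differ by a switch if $\alpha'\alpha$ is a product of two disjoint transpositions (two edges are replaced by two other edges on the same four half-edges); if the number of components satisfies $\gamma(\mathfrak m')=\gamma(\mathfrak m)+1$ one writes $\mathfrak m'<\mathfrak m$. (The switches appearing in the statement are those the paper calls chromatic: both switched edges join a vertex labelled in $\mathcal I_1$ to one labelled in $\mathcal I_0$.) The constant in $O(1/N)$ may depend on $\mathfrak m$ but not on $N$. *)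

(* Defs.v *)
From HB Require Import structures.
From mathcomp Require Import all_boot all_order all_algebra all_fingroup.
From mathcomp Require Import complex.
From mathcomp Require Import all_classical all_reals all_analysis.
Set Implicit Arguments.
Unset Strict Implicit.
Unset Printing Implicit Defensive.
Import Order.TTheory GRing.Theory Num.Theory.
Import numFieldNormedType.Exports.
Local Open Scope classical_set_scope.
Local Open Scope ring_scope.
Local Open Scope complex_scope.

Section Cycles.
Context (n : nat).
Implicit Type s : {perm 'I_n}.

(* Fixed points count as cycles of length 1. *)
Definition cycle_of s := {c : {set 'I_n} | c \in porbits s}.

Lemma mem_cycle_at s (e : 'I_n) : porbit s e \in porbits s.
Proof. exact: imset_f. Qed.

Definition cycle_at s (e : 'I_n) : cycle_of s :=
  exist (fun c => c \in porbits s) _ (mem_cycle_at s e).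

Lemma cycle_nonempty s (c : cycle_of s) : exists e, e \in val c.
Proof. by case: c => c /= /imsetP[e _ ->]; exists e; exact: porbit_id. Qed.

Definition cycle_least s (c : cycle_of s) : 'I_n :=
  [arg min_(e < xchoose (cycle_nonempty c) in val c) (e : nat)]%N.

End Cycles.

(* The half-edges 1, ..., n are the elements of 'I_n; a fixed point of [eperm]
   is a boundary edge. *)
Record cmap (n : nat) := CMap {
  vperm : {perm 'I_n};
  eperm : {perm 'I_n};
  epermK : involutive eperm }.

Section Maps.
Context (n : nat).
Implicit Type m : cmap n.

Definition vertex m := cycle_of (vperm m).
Definition edge m := cycle_of (eperm m).
Definition vertex_at m (e : 'I_n) : vertex m := cycle_at (vperm m) e.
Definition edge_at m (e : 'I_n) : edge m := cycle_at (eperm m) e.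
Definition deg m (v : vertex m) : nat := #|val v|.

(* [bdry v k], for k < deg v, is the k-th entry of the cycle of v started at
   its least element. *)
Definition bdry m (v : vertex m) (k : nat) : 'I_n :=
  iter k (vperm m) (cycle_least v).

Definition nboundary m : nat := #|[pred e | eperm m e == e]|.

Definition ncomp m : nat :=
  #|[set orbit 'P <<[set vperm m; eperm m]>>%g e | e : 'I_n]%SET|.

Definition connected_map m := ncomp m == 1%N.

(* [(a * a')%g] is the composition of [a] followed by [a']. *)
Definition is_switch (a a' : {perm 'I_n}) :=
  [exists x, exists y, exists z, exists t,
    uniq [:: x; y; z; t] && ((a * a')%g == (tperm x y * tperm z t)%g)].

Definition map_lt m' m :=
  [&& vperm m' == vperm m, is_switch (eperm m) (eperm m')
    & ncomp m' == (ncomp m).+1].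

(* The involution obtained from [a] by matching x with y and [a x] with [a y];
   the conjugate is an involution for all x and y, and agrees with that
   description when the four half-edges are distinct ([rematchE]). *)
Definition rematch (a : {perm 'I_n}) (x y : 'I_n) : {perm 'I_n} :=
  (a ^ tperm (a x) y)%g.

Lemma rematchK (a : {perm 'I_n}) x y :
  involutive a -> involutive (rematch a x y).
Proof.
move=> aK z; rewrite /rematch.
by rewrite -(permKV (tperm (a x) y) z) !permJ aK.
Qed.

Lemma rematchE (a : {perm 'I_n}) x y :
  involutive a -> uniq [:: x; a x; y; a y] ->
  [/\ rematch a x y x = y, rematch a x y (a x) = a y &
      forall z, z \notin [:: x; a x; y; a y] -> rematch a x y z = a z].
Proof.
move=> aK /=; rewrite !inE !negb_or => /andP[/and3P[xax xy xay] /and3P[]].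
move=> /andP[axy axay] yay _; rewrite /rematch; split.
- have {2}-> : x = tperm (a x) y x by rewrite tpermD // eq_sym.
  by rewrite permJ tpermL.
- have {2}-> : a x = tperm (a x) y y by rewrite tpermR.
  by rewrite permJ tpermD // eq_sym.
- move=> z; rewrite !inE !negb_or => /and4P[zx zax zy zay].
  have {1}-> : z = tperm (a x) y z by rewrite tpermD // eq_sym.
  rewrite permJ tpermD //.
    by rewrite (inj_eq (@perm_inj _ a)) eq_sym.
  by apply: contra zay => /eqP ->; rewrite aK.
Qed.

Lemma rematch_is_switch (a : {perm 'I_n}) x y :
  involutive a -> uniq [:: x; a x; y; a y] -> is_switch a (rematch a x y).
Proof.
move=> aK u; have [e1 e2 e3] := rematchE aK u.
have rK := rematchK x y aK.
move: (rematch a x y) e1 e2 e3 rK => r e1 e2 e3 rK.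
have e1' : r y = x by rewrite -e1 rK.
have e2' : r (a y) = a x by rewrite -e2 rK.
apply/existsP; exists (a x); apply/existsP; exists y.
apply/existsP; exists x; apply/existsP; exists (a y).
move: u => /=; rewrite !inE !negb_or !andbT => /and3P[/and3P[xax xy xay]].
move=> /andP[axy axay] yay.
rewrite ![_ == x]eq_sym axy xax axay xy yay xay /=; apply/eqP/permP => z.
rewrite !permM.
have [->|zx] := eqVneq z x; first by rewrite e2 (@tpermD _ _ _ x) ?tpermL // eq_sym.
have [->|zax] := eqVneq z (a x); first by rewrite aK e1 tpermL tpermD // eq_sym.
have [->|zy] := eqVneq z y; first by rewrite e2' tpermR tpermD // eq_sym.
have [->|zay] := eqVneq z (a y).
  by rewrite aK e1' (@tpermD _ _ _ (a y)) // ?tpermR // eq_sym.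
rewrite e3 ?aK; last first.
  rewrite !inE !negb_or (inj_eq (@perm_inj _ a)) zx.
  rewrite (inj_eq (@perm_inj _ a)) zy !andbT /=.
  apply/andP; split; first by apply: contra zax => /eqP <-; rewrite aK.
  by apply: contra zay => /eqP <-; rewrite aK.
by rewrite !tpermD // eq_sym.
Qed.

Definition switch m (e f : 'I_n) : cmap n :=
  CMap (vperm m) (rematchK e f (@epermK n m)).

End Maps.

Record imap (I : Type) (ell : I -> nat) (n : nat) := IMap {
  imap_map :> cmap n;
  label : vertex imap_map -> I;
  labelP : forall v, ell (label v) = deg v }.

Section IMaps.
Context (I : Type) (ell : I -> nat) (n : nat).
Implicit Type m : imap ell n.

Definition hlabel m (e : 'I_n) : I := label (vertex_at m e).

Definition iswitch m (e f : 'I_n) : imap ell n :=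
  @IMap I ell n (switch m e f) (@label I ell n m) (@labelP I ell n m).

(* m^+_{e,f} and m^-_{e,f}; in the latter alpha(e) is matched with
   alpha(alpha(f)) = f. *)
Definition iswitch_plus m (e f : 'I_n) := iswitch m e f.
Definition iswitch_minus m (e f : 'I_n) := iswitch m e (eperm m f).

End IMaps.

Section Tensors.
Context (R : realType).
Local Notation C := R[i].

(* Coordinates of an element of (C^N)^{\otimes p} in the canonical basis. *)
Definition tensor (N p : nat) := {ffun p.-tuple 'I_N -> C}.

Definition tensor_family (I : Type) (ell : I -> nat) (N : nat) :=
  forall i : I, tensor N (ell i).

(* Since ell (label v) = deg v, the tuple below runs through all of the cycle
   of v. *)
Definition trace_action (I : Type) (ell : I -> nat) (n : nat) (m : imap ell n)
    (N : nat) (A : tensor_family ell N) : C :=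
  (N%:R ^+ ncomp m)^-1 *
  \sum_(i : {ffun edge m -> 'I_N}) \prod_(v : vertex m)
    A (label v) [tuple i (edge_at m (bdry v k)) | k < ell (label v)].

Definition rotate (N p : nat) (T : tensor N p) (U : 'M[R]_N) : tensor N p :=
  [ffun j : p.-tuple 'I_N => \sum_(i : p.-tuple 'I_N)
     T i * \prod_(k < p) (U (tnth j k) (tnth i k))%:C].

Definition rotate_family (I : Type) (ell : I -> nat) (N : nat)
    (A : tensor_family ell N) (U : 'M[R]_N) : tensor_family ell N :=
  fun i => rotate (A i) U.

Definition sum_order (I0 I1 : Type) (ell0 : I0 -> nat) (ell1 : I1 -> nat)
    (i : I0 + I1) : nat :=
  match i with inl i0 => ell0 i0 | inr i1 => ell1 i1 end.

Definition sum_family (I0 I1 : Type) (ell0 : I0 -> nat) (ell1 : I1 -> nat)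
    (N : nat) (A0 : tensor_family ell0 N) (A1 : tensor_family ell1 N) :
    tensor_family (sum_order ell0 ell1) N :=
  fun i => match i with inl i0 => A0 i0 | inr i1 => A1 i1 end.

Definition in_right (I0 I1 : Type) (i : I0 + I1) : bool :=
  if i is inr _ then true else false.

Definition bounded_traces (I : Type) (ell : I -> nat)
    (A : forall N, tensor_family ell N) : Prop :=
  forall (n : nat) (m : imap ell n), nboundary m = 0%N ->
  exists c : R, forall N : nat, (0 < N)%N ->
    `|trace_action m (A N)| <= c%:C.

Definition orthogonal_mx (N : nat) (V : 'M[R]_N) : Prop := V *m V^T = 1%:M.

Definition borel_mx (N : nat) :=
  g_sigma_algebraType [set B : set 'M[R]_N | open B].

(* On the compact group O(N), the Haar measure is the only left-invariant Borel
   probability measure. *)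
Definition haar_distributed (d : measure_display) (Omega : measurableType d)
    (P : probability Omega R) (N : nat) (U : Omega -> 'M[R]_N) : Prop :=
  [/\ measurable_fun setT (U : Omega -> borel_mx N),
      forall w, orthogonal_mx (U w) &
      forall (V : 'M[R]_N) (B : set (borel_mx N)),
        orthogonal_mx V -> measurable B ->
        pushforward P (fun w => V *m U w : borel_mx N) B =
        pushforward P (U : Omega -> borel_mx N) B].

Definition Cexpectation (d : measure_display) (Omega : measurableType d)
    (P : probability Omega R) (X : Omega -> C) : C :=
  fine ('E_P[fun w => complex.Re (X w)])%E
    +i* fine ('E_P[fun w => complex.Im (X w)])%E.

Definition mixed_expectation (I0 I1 : Type)
    (ell0 : I0 -> nat) (ell1 : I1 -> nat) (N : nat)
    (A0 : tensor_family ell0 N) (A1 : tensor_family ell1 N)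
    (d : measure_display) (Omega : measurableType d) (P : probability Omega R)
    (U : Omega -> 'M[R]_N) (n : nat) (m : imap (sum_order ell0 ell1) n) : C :=
  Cexpectation P (fun w =>
    trace_action m (sum_family A0 (rotate_family A1 (U w)))).

End Tensors.

(* Main.v *)
Require Import Defs.
From HB Require Import structures.
From mathcomp Require Import all_boot all_order all_algebra all_fingroup.
From mathcomp Require Import complex.
From mathcomp Require Import all_classical all_reals all_analysis.
From mathcomp Require Import measurable_realfun ring lra.

(* Write [S alpha] for the sum, over the maps i from the half-edges to [N] that
   are constant on the edges of alpha, of g i, the expectation of the product of
   the tensor entries read along the vertices; g does not depend on alpha, and
   E_N[m] = N^-gamma(m) S alpha.  To first order, the invariance of the Haar
   measure under the rotations of the plane (x, y) says that the sum of
   g (i[h := y]) over the rotated half-edges h with i h = x is unchanged when x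
   and y are exchanged.  For x = i e and y = i (alpha e), summing over i turns the
   term h = e into N S and S respectively, and the term h = f into the switches
   m^-_{e,f} and m^+_{e,f}; the f with alpha f rotated too cancel in pairs.  A
   switch creates at most one component, so dividing by N^2 gives the statement,
   provided that E_N is bounded on all maps.  This follows from the same equation
   by induction on the number of chromatic edges, which m^+ decreases and m^-
   preserves.  Without chromatic edges U_N disappears by orthogonality, and the
   map is the union of an I_0-map and an I_1-map. *)

Set Implicit Arguments.
Unset Strict Implicit.
Unset Printing Implicit Defensive.
Import Order.TTheory GRing.Theory Num.Theory.
Import numFieldNormedType.Exports.
Local Open Scope classical_set_scope.
Local Open Scope ring_scope.
Local Open Scope complex_scope.

(** * Loop equations *)

Section Update.
Context (aT : finType) (rT : Type).
Implicit Types (i : {ffun aT -> rT}) (h : aT) (y : rT).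

Definition upd i h y : {ffun aT -> rT} := [ffun k => if k == h then y else i k].

Lemma upd_eq i h y : upd i h y h = y.
Proof. by rewrite ffunE eqxx. Qed.

Lemma upd_neq i h y k : k != h -> upd i h y k = i k.
Proof. by move=> /negPf kh; rewrite ffunE kh. Qed.

Lemma upd_upd i h y z : upd (upd i h y) h z = upd i h z.
Proof. by apply/ffunP => k; rewrite !ffunE; case: eqP. Qed.

Lemma upd_id i h : upd i h (i h) = i.
Proof. by apply/ffunP => k; rewrite ffunE; case: eqP => [->|]. Qed.

End Update.

Section LoopEquation.
Context (V : zmodType) (n N : nat).
Implicit Types (a : {perm 'I_n}) (i : {ffun 'I_n -> 'I_N}).

Definition matched a i := [forall h, i (a h) == i h].

Lemma matchedP a i : reflect (forall h, i (a h) = i h) (matched a i).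
Proof. exact: 'forall_eqP. Qed.

Definition matched_sum (g : {ffun 'I_n -> 'I_N} -> V) a :=
  \sum_(i | matched a i) g i.

(** The edge of [e] is cut open: its two ends may carry different indices, and these indices choose
    the plane of the rotation. *)
Definition matched_off a (e : 'I_n) i :=
  [forall h, [|| h == e, h == a e | i (a h) == i h]].

Lemma matched_offP a e i : involutive a ->
  reflect (forall h, h != e -> h != a e -> i (a h) = i h) (matched_off a e i).
Proof.
move=> aK; apply: (iffP forallP) => [ai h he hae|ai h].
  by have := ai h; rewrite (negPf he) (negPf hae) => /eqP.
by case: eqVneq => //= he; case: eqVneq => //= hae; apply/eqP/ai.
Qed.

(** The summand does not see [i e]. Over each matched index, the fibre of [i |-> upd i e (i (a e))]
    has [N] elements, one for each value erased at [e]. *)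
Lemma sum_diagonal (g : {ffun 'I_n -> 'I_N} -> V) a e :
  involutive a -> a e != e ->
  \sum_(i | matched_off a e i) g (upd i e (i (a e))) = matched_sum g a *+ N.
Proof.
move=> aK aee.
rewrite (partition_big (fun i => upd i e (i (a e))) (matched a)) /=; last first.
  move=> i /matched_offP -/(_ aK) ai; apply/matchedP => h.
  have [->|he] := eqVneq h e; first by rewrite upd_eq upd_neq.
  have [->|hae] := eqVneq h (a e); first by rewrite aK upd_eq upd_neq.
  rewrite !upd_neq ?ai //.
  by apply: contra hae => /eqP <-; rewrite aK.
rewrite -sumrMnl; apply: eq_bigr => i' /matchedP i'a.
rewrite (eq_bigr (fun=> g i')); last by move=> i /andP[_ /eqP ->].
rewrite sumr_const; congr (_ *+ _).
have upd_inj : injective (upd i' e).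
  by move=> x y /ffunP/(_ e); rewrite !upd_eq.
rewrite -[RHS](card_ord N) -(fintype.card_image upd_inj 'I_N); apply: eq_card => i.
rewrite unfold_in; apply/andP/fintype.imageP => [[_ /eqP ei]|[x _ ->]].
  exists (i e) => //; apply/ffunP => h.
  have [->|he] := eqVneq h e; first by rewrite upd_eq.
  by rewrite -ei !upd_neq.
split; last first.
  by rewrite upd_upd upd_neq // i'a upd_id.
apply/matched_offP => // h he hae.
rewrite !upd_neq //.
by apply: contra hae => /eqP <-; rewrite aK.
Qed.

(* Moving the index of f from that of one end of the edge of e to that of the
   other end performs the switch matching e with a f. *)
Lemma sum_switch (g : {ffun 'I_n -> 'I_N} -> V) a e f :
  involutive a -> uniq [:: e; a e; f; a f] ->
  \sum_(i | matched_off a e i && (i f == i e)) g (upd i f (i (a e))) =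
  matched_sum g (rematch a e (a f)).
Proof.
move=> aK u.
have u' : uniq [:: e; a e; a f; a (a f)].
  rewrite aK; move: u; rewrite (perm_uniq (s2 := [:: e; a e; a f; f])) //.
  by rewrite perm_cons perm_cons (perm_catC [:: _] [:: _]).
have [r1 r2 r3] := rematchE aK u'; have rK := rematchK e (a f) aK.
rewrite aK in r2 r3.
have r1' : rematch a e (a f) (a f) = e by apply: (can_inj rK); rewrite rK r1.
have r2' : rematch a e (a f) f = a e by apply: (can_inj rK); rewrite rK r2.
move: u => /=; rewrite !inE !negb_or !andbT.
move=> /and3P[/and3P[eae ef eaf] /andP[aef aeaf] faf].
(* The inverse change of variables gives [f] back the index of [e]; being fixed by the round trip is
   exactly the constraint [i f = i e]. *)
rewrite /matched_sum
  [RHS](reindex_onto (fun i => upd i f (i (a e))) (fun i => upd i f (i e))) /=.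
  apply: eq_big => // i; apply/andP/andP => [[/(matched_offP _ _ aK) ai /eqP ife]|].
    split; last first.
      rewrite upd_upd upd_neq // -ife upd_id //.
    apply/matchedP => h.
    have iaf : i (a f) = i f by apply: ai; rewrite eq_sym.
    have [->|he] := eqVneq h e.
      by rewrite r1 !upd_neq // 1?eq_sym // iaf.
    have [->|hae] := eqVneq h (a e).
      by rewrite r2 upd_eq upd_neq.
    have [->|hf] := eqVneq h f.
      by rewrite r2' upd_eq upd_neq.
    have [->|haf] := eqVneq h (a f).
      by rewrite r1' (upd_neq _ _ ef) upd_neq ?iaf // eq_sym.
    rewrite r3; last by rewrite !inE !negb_or he hae hf haf.
    have ahf : a h != f by apply: contra haf => /eqP <-; rewrite aK.
    by rewrite !upd_neq // ai.
  move=> [/matchedP ri /eqP iE].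
  have ife : i f = i e by rewrite -{1}iE upd_eq upd_neq.
  split; last by rewrite ife.
  apply/matched_offP => // h he hae.
  have := ri e; rewrite r1 !upd_neq // 1?eq_sym // => iaf.
  have [->|hf] := eqVneq h f; first by rewrite iaf ife.
  have [->|haf] := eqVneq h (a f); first by rewrite aK iaf ife.
  have := ri h; rewrite r3; last by rewrite !inE !negb_or he hae hf haf.
  have ahf : a h != f by apply: contra haf => /eqP <-; rewrite aK.
  by rewrite !upd_neq.
move=> i /matchedP ri; rewrite upd_upd upd_neq //.
by rewrite -(ri (a e)) r2 upd_id.
Qed.

(** A switch is determined by its pair of new edges, and both sides create [{e, f}] and
    [{a e, a f}]. *)
Lemma rematch_swap a e f : involutive a -> uniq [:: e; a e; f; a f] ->
  rematch a (a e) (a f) = rematch a e f.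
Proof.
move=> aK u; have [r1 r2 r3] := rematchE aK u.
have u' : uniq [:: a e; a (a e); a f; a (a f)].
  rewrite !aK; move: u; rewrite /= !inE !negb_or !andbT.
  move=> /and3P[/and3P[x1 x2 x3] /andP[x4 x5] x6].
  by rewrite (eq_sym (a e) e) x1 x5 x4 x3 x2 eq_sym x6.
have [q1 q2 q3] := rematchE aK u'; rewrite !aK in q1 q2 q3.
have rK := rematchK e f aK; have qK := rematchK (a e) (a f) aK.
apply/permP => z.
have [->|ze] := eqVneq z e; first by rewrite r1 q2.
have [->|zae] := eqVneq z (a e); first by rewrite r2 q1.
have [->|zf] := eqVneq z f; first by rewrite -(canRL rK r1) -(canRL qK q2).
have [->|zaf] := eqVneq z (a f); first by rewrite -(canRL rK r2) -(canRL qK q1).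
by rewrite r3 ?q3 // !inE !negb_or ze zae zf zaf.
Qed.

Lemma matched_off_swap a e i : involutive a ->
  matched_off a (a e) i = matched_off a e i.
Proof. by move=> aK; apply: eq_forallb => h; rewrite aK orbCA. Qed.

(** The invariance [rot_inv] is taken at [x = i e] and [y = i (a e)] and summed over
    [matched_off a e]. Only half-edges in [H] are moved, so [a e] contributes no term. *)
Lemma loop_equation (H : pred 'I_n) (g : {ffun 'I_n -> 'I_N} -> V)
    (rot_inv : forall x y i, \sum_(h | H h && (i h == x)) g (upd i h y) =
                             \sum_(h | H h && (i h == y)) g (upd i h x))
    a e : involutive a -> (forall h, a h != h) -> H e -> ~~ H (a e) ->
  matched_sum g a *+ N =
  matched_sum g a + \sum_(f | [&& f != e, H f & ~~ H (a f)])
    (matched_sum g (rematch a e f) - matched_sum g (rematch a e (a f))).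
Proof.
move=> aK aF He Hae.
have u f : H f -> f != e -> a f != e -> uniq [:: e; a e; f; a f].
  move=> Hf fe afe /=; rewrite !inE !negb_or !andbT.
  rewrite [e == a e]eq_sym aF [e == f]eq_sym fe [e == a f]eq_sym afe.
  rewrite (inj_eq (@perm_inj _ a)) [e == f]eq_sym fe [f == a f]eq_sym aF !andbT /=.
  by apply: contraNneq Hae => ->.
have afe f : H f -> a f != e.
  by move=> Hf; apply: contraNneq Hae => <-; rewrite aK.
have exch (p q : 'I_n) :
    \sum_(i | matched_off a e i) \sum_(h | H h && (i h == i p)) g (upd i h (i q)) =
    \sum_(h | H h) \sum_(i | matched_off a e i && (i h == i p)) g (upd i h (i q)).
  rewrite (exchange_big_dep H) /=; last by move=> i h _ /andP[].
  by apply: eq_bigr => h Hh; apply: eq_bigl => i; rewrite Hh.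
have : \sum_(i | matched_off a e i)
         \sum_(h | H h && (i h == i e)) g (upd i h (i (a e))) =
       \sum_(i | matched_off a e i)
         \sum_(h | H h && (i h == i (a e))) g (upd i h (i e)).
  by apply: eq_bigr => i _; apply: rot_inv.
rewrite !exch (bigD1 e) //= [in RHS](bigD1 e) //=.
under eq_bigl do rewrite eqxx andbT.
rewrite sum_diagonal // => E.
(* On this side the term [h = e] forces the two ends of the edge to agree, so no index is left free
   and no factor [N] appears. *)
have E1 : \sum_(i | matched_off a e i && (i e == i (a e))) g (upd i e (i e)) =
          matched_sum g a.
  apply: eq_big => [i|i _]; last by rewrite upd_id.
  apply/andP/matchedP => [[/(matched_offP _ _ aK) ai /eqP ie] h|ai].
    have [->|he] := eqVneq h e; first by rewrite ie.
    have [->|hae] := eqVneq h (a e); first by rewrite aK ie.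
    exact: ai.
  by split; [apply/matched_offP => // | rewrite ai].
have E2 : \sum_(h | H h && (h != e))
     \sum_(i | matched_off a e i && (i h == i e)) g (upd i h (i (a e))) =
    \sum_(h | H h && (h != e)) matched_sum g (rematch a e (a h)).
  by apply: eq_bigr => f /andP[Hf fe]; rewrite sum_switch // u // afe.
(* This is the previous sum with [e] and [a e] exchanged, followed by [rematch_swap]. *)
have E3 : \sum_(h | H h && (h != e))
     \sum_(i | matched_off a e i && (i h == i (a e))) g (upd i h (i e)) =
    \sum_(h | H h && (h != e)) matched_sum g (rematch a e h).
  apply: eq_bigr => f /andP[Hf fe].
  have uf := u f Hf fe (afe f Hf).
  transitivity (\sum_(i | matched_off a (a e) i && (i f == i (a e)))
      g (upd i f (i (a (a e))))).
    by rewrite aK; apply: eq_bigl => i; rewrite matched_off_swap.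
  rewrite sum_switch //; last first.
    rewrite aK; apply: etrans uf; apply: perm_uniq.
    exact: (permEl (perm_catCA [:: _] [:: _] [:: _; _])).
  by rewrite rematch_swap.
rewrite E1 E2 E3 in E.
have := congr1
  (fun z => z - \sum_(h | H h && (h != e)) matched_sum g (rematch a e (a h))) E.
rewrite addrK -addrA => ->; congr (_ + _).
(* The half-edges [f] with [a f] also in [H] contribute zero: [f |-> a f] permutes them and
   exchanges the two families of switches. *)
rewrite -sumrB (bigID (fun f => H (a f))) /= [X in X + _]sumrB.
rewrite [X in X - _](reindex_inj (@perm_inj _ a)) /=.
under [X in X - _]eq_bigl => f.
  rewrite aK.
  have -> : [&& H (a f) && (a f != e) & H f] = (H f && (f != e)) && H (a f).
    case: (boolP (H f)) => Hf; rewrite ?andbF //= andbT.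
    case: (boolP (H (a f))) => Haf /=; rewrite ?andbF //= andbT.
    rewrite afe //; apply/esym; apply: contraNneq Hae => <- //.
  over.
rewrite subrr add0r; apply: eq_bigl => f.
by rewrite andbA [H f && _]andbC.
Qed.

End LoopEquation.

(** * Connected components under a switch *)

Section Components.
Context (n : nat).
Implicit Types (m : cmap n) (x y : 'I_n).

Definition comp m x : {set 'I_n} := (orbit 'P <<[set vperm m; eperm m]>>%g x)%SET.

Lemma ncompE m : ncomp m = #|[set comp m x | x : 'I_n]%SET|.
Proof. by []. Qed.

Lemma comp_gen m s x : s \in [set vperm m; eperm m]%SET -> comp m (s x) = comp m x.
Proof.
by move=> sm; apply/orbit_eqP/imsetP; exists s; rewrite ?mem_gen.
Qed.

Lemma comp_vperm m x : comp m (vperm m x) = comp m x.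
Proof. by apply: comp_gen; rewrite !inE eqxx. Qed.

Lemma comp_eperm m x : comp m (eperm m x) = comp m x.
Proof. by apply: comp_gen; rewrite !inE eqxx orbT. Qed.

(** The permutations preserving [F] form a group; it contains both generators, hence the whole group
    whose orbits are the components. *)
Lemma comp_invariant (X : eqType) (F : 'I_n -> X) m :
  (forall x, F (vperm m x) = F x) -> (forall x, F (eperm m x) = F x) ->
  forall x y, comp m x = comp m y -> F x = F y.
Proof.
move=> Fv Fe x y xy.
pose K := [set s : {perm 'I_n} | [forall z, F (s z) == F z]]%SET.
have KP s : s \in K -> forall z, F (s z) = F z.
  by rewrite inE => /forallP sK z; apply/eqP.
have gK : group_set K.
  apply/group_setP; split; first by rewrite inE; apply/forallP => z; rewrite perm1.
  move=> s t sK tK; rewrite inE; apply/forallP => z.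
  by rewrite permM KP // KP.
have sub : (<<[set vperm m; eperm m]>>%g \subset Group gK)%SET.
  rewrite gen_subG; apply/fintype.subsetP => s; rewrite !inE => /orP[]/eqP ->;
  by apply/forallP => z; rewrite ?Fv ?Fe.
have : x \in comp m y by rewrite -xy orbit_refl.
by case/imsetP => s /(fintype.subsetP sub) sK ->; rewrite /= apermE KP.
Qed.

(** An invariant [F] factors through the components, so lower bounds on [ncomp] follow from
    invariants taking many values. *)
Lemma leq_card_imset_comp (X : finType) (F : 'I_n -> X) m :
  (forall x, F (vperm m x) = F x) -> (forall x, F (eperm m x) = F x) ->
  (#|[set F x | x : 'I_n]%SET| <= ncomp m)%N.
Proof.
move=> Fv Fe; rewrite ncompE.
have [x0 _|no] := pickP 'I_n; last first.
  rewrite (_ : [set F x | x : 'I_n]%SET = finset.set0) ?cards0 //.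
  by apply/setP => y; rewrite !inE; apply/imsetP => -[x]; have := no x.
(* [G] reads [F] at some point of a component; the default [F x0] is for the empty set, which is not
   a component. *)
pose G (c : {set 'I_n}) := if [pick y in c] is Some y then F y else F x0.
apply: leq_trans (leq_imset_card G _); apply: subset_leq_card.
apply/fintype.subsetP => _ /imsetP[x _ ->]; apply/imsetP.
exists (comp m x); first exact: imset_f.
rewrite /G; case: pickP => [y|/(_ x)]; last by rewrite orbit_refl.
by move=> /orbit_eqP yx; apply: (comp_invariant Fv Fe); apply/esym.
Qed.

(** Merging the components of [e] and [a e] in the switched map gives an invariant of the original
    map, since these two components contain all four half-edges. The merging loses at most one
    value. *)
Lemma leq_ncomp_switch m e f :
  uniq [:: e; eperm m e; f; eperm m f] -> (ncomp (switch m e f) <= (ncomp m).+1)%N.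
Proof.
move=> u; have [r1 r2 r3] := rematchE (@epermK _ m) u.
set m' := switch m e f; set a := eperm m in u r1 r2 r3 *.
have compr x : comp m' (rematch a e f x) = comp m' x by apply: (comp_eperm m').
pose F x := if comp m' x == comp m' (a e) then comp m' e else comp m' x.
have Fv x : F (vperm m x) = F x by rewrite /F (comp_vperm m').
have FaeE : F (a e) = comp m' e by rewrite /F eqxx.
have FeE : F e = comp m' e by rewrite /F; case: ifP.
have FfE : F f = comp m' e by rewrite /F -r1 compr; case: ifP.
have FafE : F (a f) = comp m' e by rewrite /F -r2 compr eqxx.
have Fe x : F (a x) = F x.
  have [->|xe] := eqVneq x e; first by rewrite FaeE FeE.
  have [->|xae] := eqVneq x (a e); first by rewrite (epermK m) FaeE FeE.
  have [->|xf] := eqVneq x f; first by rewrite FafE FfE.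
  have [->|xaf] := eqVneq x (a f); first by rewrite (epermK m) FafE FfE.
  have <- : rematch a e f x = a x by apply: r3; rewrite !inE !negb_or xe xae xf.
  by rewrite /F compr.
have := leq_card_imset_comp Fv Fe; rewrite -ltnS; apply: leq_trans.
rewrite [ncomp m']ncompE (cardsD1 (comp m' (a e))) -addn1 addnC leq_add ?leq_b1 //.
apply: subset_leq_card; apply/fintype.subsetP => c /setD1P[xa /imsetP[x _ xE]].
by apply/imsetP; exists x => //; rewrite /F -xE (negPf xa).
Qed.

End Components.

Section Decomposition.
Context (n k l : nat) (phi : 'I_k -> 'I_n) (psi : 'I_l -> 'I_n).

(** The component of a half-edge in [m1] or [m2], tagged by the side, is an invariant of [m]. The
    inequality controls the power of [N] when a trace factors over two parts. *)
Lemma leq_ncompD (m : cmap n) (m1 : cmap k) (m2 : cmap l) :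
  injective phi -> injective psi -> (forall x y, phi x != psi y) ->
  (forall h, (exists x, h = phi x) \/ (exists y, h = psi y)) ->
  (forall x, phi (vperm m1 x) = vperm m (phi x)) ->
  (forall x, phi (eperm m1 x) = eperm m (phi x)) ->
  (forall x, psi (vperm m2 x) = vperm m (psi x)) ->
  (forall x, psi (eperm m2 x) = eperm m (psi x)) ->
  (ncomp m1 + ncomp m2 <= ncomp m)%N.
Proof.
move=> phiI psiI dis cov pv pe qv qe.
pose F h : option ({set 'I_k} + {set 'I_l}) :=
  if [pick x | phi x == h] is Some x then Some (inl (comp m1 x)) else
  if [pick y | psi y == h] is Some y then Some (inr (comp m2 y)) else None.
have Fphi x : F (phi x) = Some (inl (comp m1 x)).
  rewrite /F; case: pickP => [y /eqP/phiI -> //|/(_ x)]; by rewrite eqxx.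
have Fpsi x : F (psi x) = Some (inr (comp m2 x)).
  rewrite /F; case: pickP => [y|_]; first by rewrite (negPf (dis _ _)).
  case: pickP => [y /eqP/psiI -> //|/(_ x)]; by rewrite eqxx.
have Fv h : F (vperm m h) = F h.
  by case: (cov h) => -[x ->]; rewrite -?pv -?qv ?Fphi ?Fpsi comp_vperm.
have Fe h : F (eperm m h) = F h.
  by case: (cov h) => -[x ->]; rewrite -?pe -?qe ?Fphi ?Fpsi comp_eperm.
apply: leq_trans (leq_card_imset_comp Fv Fe); rewrite !ncompE.
have inlI : injective
    (fun c : {set 'I_k} => Some (inl c) : option ({set 'I_k} + {set 'I_l})).
  by move=> x y [].
have inrI : injective
    (fun c : {set 'I_l} => Some (inr c) : option ({set 'I_k} + {set 'I_l})).
  by move=> x y [].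
rewrite -(card_imset _ inlI) -(card_imset _ inrI) -cardsUI.
rewrite (_ : (_ :&: _)%SET = finset.set0) ?cards0 ?addn0.
  apply: subset_leq_card.
  apply/fintype.subsetP => _ /finset.setUP[]/imsetP[_ /imsetP[x _ ->] ->].
    by rewrite -Fphi; exact: imset_f.
  by rewrite -Fpsi; exact: imset_f.
apply/setP => z; by rewrite !inE; apply/negP => /andP[/imsetP[c _ ->] /imsetP[c' _]].
Qed.

End Decomposition.

(** * Traces as sums over half-edges *)

Section CycleTheory.
Context (n : nat) (s : {perm 'I_n}).
Implicit Types (c : cycle_of s) (h : 'I_n).

Lemma cycle_at_val c h : h \in val c -> cycle_at s h = c.
Proof.
case: c => c cP /= hc; apply: val_inj => /=; case/imsetP: (cP) hc => x _ ->.
by rewrite -eq_porbit_mem => /eqP.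
Qed.

Lemma cycle_at_step h : cycle_at s (s h) = cycle_at s h.
Proof.
by apply: cycle_at_val; rewrite /= -{1}[s]expg1 mem_porbit.
Qed.

(** Least half-edges stand for the cycles in products, so that maps with different types of vertices
    can be compared. *)
Definition least h := [forall x in porbit s h, (h <= x)%N].

Lemma cycle_least_in c : cycle_least c \in val c.
Proof.
by rewrite /cycle_least; case: arg_minnP => //; exact: xchooseP.
Qed.

Lemma cycle_least_min c x : x \in val c -> (cycle_least c <= x)%N.
Proof.
rewrite /cycle_least; case: arg_minnP => [|h _ hmin]; last exact: hmin.
exact: xchooseP.
Qed.

Lemma cycle_leastK c : cycle_at s (cycle_least c) = c.
Proof. exact/cycle_at_val/cycle_least_in. Qed.

Lemma least_cycle_least c : least (cycle_least c).
Proof.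
apply/forall_inP => x; rewrite -[porbit _ _]/(val (cycle_at s _)) cycle_leastK.
exact: cycle_least_min.
Qed.

Lemma cycle_at_leastK h : least h -> cycle_least (cycle_at s h) = h.
Proof.
move=> /forall_inP hmin; apply/val_inj/eqP; rewrite eqn_leq.
rewrite hmin ?cycle_least_min //=; first exact: porbit_id.
exact: (cycle_least_in (cycle_at s h)).
Qed.

Lemma big_cycle_least (T : Type) (idx : T) (op : Monoid.com_law idx)
    (F : cycle_of s -> T) :
  \big[op/idx]_c F c = \big[op/idx]_(h | least h) F (cycle_at s h).
Proof.
rewrite [RHS](reindex_onto (@cycle_least n s) (cycle_at s)) /=; last first.
  by move=> h hl; rewrite cycle_at_leastK.
by apply: eq_big => [c|c _]; rewrite ?cycle_leastK // least_cycle_least eqxx.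
Qed.

Lemma big_cycle_iter (T : Type) (idx : T) (op : Monoid.com_law idx)
    (F : 'I_n -> T) :
  \big[op/idx]_h F h =
  \big[op/idx]_(c : cycle_of s) \big[op/idx]_(k < #|val c|) F (iter k s (cycle_least c)).
Proof.
rewrite (partition_big (cycle_at s) xpredT) //=; apply: eq_bigr => c _.
set x := cycle_least c.
have cE : val c = porbit s x by rewrite -[LHS](congr1 val (cycle_leastK c)).
rewrite (eq_bigl (mem (val c))); last first.
  move=> h; apply/eqP/idP => [<-|]; first exact: porbit_id.
  exact: cycle_at_val.
rewrite (eq_bigl (mem (traject s x #|val c|))); last first.
  by move=> h; rewrite cE -[RHS]porbit_traject.
rewrite -big_uniq /=; last by rewrite cE uniq_traject_porbit.
rewrite (big_nth x) size_traject big_mkord; apply: eq_bigr => k _.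
by rewrite nth_traject.
Qed.

End CycleTheory.

(** An index constant on the cycles is recovered from its values at their least elements. The type
    summed over on the left does not depend on [a]. *)
Lemma matched_sum_cycles (V : zmodType) (n N : nat) (a : {perm 'I_n})
    (g : {ffun 'I_n -> 'I_N} -> V) :
  matched_sum g a =
  \sum_(f : {ffun cycle_of a -> 'I_N}) g [ffun h => f (cycle_at a h)].
Proof.
rewrite /matched_sum
  (reindex_onto (fun f : {ffun cycle_of a -> 'I_N} => [ffun h => f (cycle_at a h)])
                (fun i => [ffun c : cycle_of a => i (cycle_least c)])) /=.
  apply: eq_bigl => f; apply/andP; split.
    by apply/matchedP => h; rewrite !ffunE cycle_at_step.
  by apply/eqP/ffunP => c; rewrite !ffunE cycle_leastK.
move=> i /matchedP im; apply/ffunP => h; rewrite !ffunE.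
have : cycle_least (cycle_at a h) \in porbit a h := cycle_least_in (cycle_at a h).
case/porbitP => k ->; elim: k => [|k IH]; first by rewrite expg0 perm1.
by rewrite expgSr permM im IH.
Qed.

(** * Distributivity when the range of summation depends on the factor *)

Section DependentDistributivity.
Context (S : comPzRingType) (I : finType) (T : I -> finType).

(** Tuples at different vertices have different lengths, so the choices form a dependent product.
    The sums are carried to the tagged union of the [T i], where ordinary distributivity applies. *)
Lemma prod_sum_fprod (F : forall i, T i -> S) :
  \prod_i \sum_(x : T i) F i x = \sum_(t : fprod T) \prod_i F i (t i).
Proof.
rewrite (eq_bigr (fun t : fprod T => \prod_i [ffun x : T i => F i x] (t i))); last first.
  by move=> t _; apply: eq_bigr => i _; rewrite ffunE.
rewrite (@big_fprod S 0 1 _ _ I T (fun i => [ffun x : T i => F i x])).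
transitivity (\prod_i \sum_(u in tagged_with T i)
    untag 0 [ffun x : T i => F i x] u).
  apply: eq_bigr => i _; rewrite -(big_tag (fun i => [ffun x : T i => F i x])).
  by apply: eq_bigr => x _; rewrite ffunE.
by rewrite (bigA_distr_big_dep (fun i => tagged_with T i)).
Qed.

End DependentDistributivity.

Section Weight.
Context (R : realType) (I : Type) (ell : I -> nat) (n N : nat).
Local Notation C := R[i].
Implicit Types (m : imap ell n) (A : tensor_family R ell N).

Definition vindex m (i : {ffun 'I_n -> 'I_N}) (v : vertex m) :
    (ell (label v)).-tuple 'I_N := [tuple i (bdry v k) | k < ell (label v)].

Definition weight m A (i : {ffun 'I_n -> 'I_N}) : C :=
  \prod_(v : vertex m) A (label v) (vindex i v).

(** The weight depends only on the vertices and their labels, so a switch changes only the set of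
    summed indices and the power of [N]. *)
Lemma trace_actionE m A :
  trace_action m A = (N%:R ^+ ncomp m)^-1 * matched_sum (weight m A) (eperm m).
Proof.
rewrite /trace_action matched_sum_cycles; congr (_ * _).
apply: eq_bigr => f _; apply: eq_bigr => v _; congr (A _ _).
by apply: eq_from_tnth => k; rewrite !tnth_mktuple ffunE.
Qed.

Lemma ell_sum m : (\sum_(v : vertex m) ell (label v) = n)%N.
Proof.
rewrite -[RHS]card_ord -sum1_card (big_cycle_iter (vperm m)) /=.
by apply: eq_bigr => v _; rewrite labelP /deg sum1_card card_ord.
Qed.

Lemma prod_vindex (S : comPzRingType) m (F : 'I_N -> 'I_N -> vertex m -> S) i j :
  \prod_(v : vertex m) \prod_(k < ell (label v))
     F (tnth (vindex i v) k) (tnth (vindex j v) k) v =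
  \prod_h F (i h) (j h) (vertex_at m h).
Proof.
rewrite [RHS](big_cycle_iter (vperm m)) /=; apply: eq_bigr => v _.
rewrite -[#|_|]/(deg v) -labelP; apply: eq_bigr => k _.
rewrite !tnth_mktuple; congr (F _ _ _).
rewrite /vertex_at; elim: (k : nat) => [|k' IH]; first by rewrite /= cycle_leastK.
by rewrite /= cycle_at_step.
Qed.

(** Every half-edge is read along its vertex, so an index is determined by the tuples read from it.
    By [ell_sum] there are $N^n$ indices and as many families of tuples, so this reading is a
    bijection. *)
Lemma sum_vindex m (S : comPzRingType)
    (F : forall v : vertex m, (ell (label v)).-tuple 'I_N -> S) :
  \prod_v \sum_t F v t = \sum_(j : {ffun 'I_n -> 'I_N}) \prod_v F v (vindex j v).
Proof.
rewrite prod_sum_fprod.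
pose J (j : {ffun 'I_n -> 'I_N}) :
    fprod (fun v : vertex m => (ell (label v)).-tuple 'I_N) :=
  [fprod v => vindex j v].
have JE j v : J j v = vindex j v by rewrite /J fprodE.
have Jinj : injective J.
  move=> j j' /fprodP jj; apply/ffunP => h.
  have hv : h \in val (vertex_at m h) by exact: porbit_id.
  set v := vertex_at m h in hv.
  have cE : val v = porbit (vperm m) (cycle_least v).
    by rewrite -[LHS](congr1 val (cycle_leastK v)).
  move: hv; rewrite cE porbit_traject => /trajectP[k].
  rewrite -cE -[#|_|]/(deg v) -labelP => kl ->.
  have := jj v; rewrite !JE => /(congr1 (fun t => tnth t (Ordinal kl))).
  by rewrite !tnth_mktuple.
rewrite (reindex J) /=; last first.
  apply: onW_bij; apply: inj_card_bij Jinj _.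
  rewrite card_fprod card_ffun !card_ord.
  rewrite (eq_bigr (fun v : vertex m => N ^ ell (label v))%N); last first.
    by move=> v _; rewrite card_tuple card_ord.
  by rewrite -expn_sum ell_sum.
by apply: eq_bigr => j _; apply: eq_bigr => v _; rewrite JE.
Qed.

End Weight.

Section RotatedWeight.
Context (R : realType) (I0 I1 : Type) (ell0 : I0 -> nat) (ell1 : I1 -> nat).
Context (n N : nat) (m : imap (sum_order ell0 ell1) n).
Context (A0 : tensor_family R ell0 N) (A1 : tensor_family R ell1 N).
Local Notation C := R[i].

Definition rotated_at (U : 'M[R]_N) (h : 'I_n) : 'M[R]_N :=
  if in_right (hlabel m h) then U else 1%:M.

Lemma sum_family_rotate (U : 'M[R]_N) (i : I0 + I1)
    (t : (sum_order ell0 ell1 i).-tuple 'I_N) :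
  sum_family A0 (rotate_family A1 U) i t =
  \sum_u sum_family A0 A1 i u *
    \prod_(k < sum_order ell0 ell1 i)
       ((if in_right i then U else 1%:M) (tnth t k) (tnth u k))%:C.
Proof.
case: i t => [i|i] t /=; last by rewrite ffunE.
rewrite (bigD1 t) //= big1 ?mulr1 => [|k _]; last by rewrite mxE eqxx.
rewrite big1 ?addr0 // => u ut.
have /existsP[k kut] : [exists k, tnth t k != tnth u k].
  rewrite -negb_forall; apply: contra ut => /forallP tu.
  by apply/eqP/eq_from_tnth => k; apply/esym/eqP.
by rewrite (bigD1 k) //= mxE (negPf kut) mul0r mulr0.
Qed.

(** By multilinearity, [j] collects the inner indices of all the rotated tensors; the identity at
    the remaining half-edges treats all vertices alike. *)
Lemma weight_rotate (U : 'M[R]_N) (i : {ffun 'I_n -> 'I_N}) :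
  weight m (sum_family A0 (rotate_family A1 U)) i =
  \sum_j weight m (sum_family A0 A1) j * \prod_h (rotated_at U h (i h) (j h))%:C.
Proof.
rewrite /weight; under eq_bigr => v _ do rewrite sum_family_rotate.
rewrite sum_vindex; apply: eq_bigr => j _; rewrite big_split /=; congr (_ * _).
by rewrite (prod_vindex (fun x y v =>
  ((if in_right (label v) then U else 1%:M) x y)%:C)).
Qed.

End RotatedWeight.

(** * Haar moments *)

Section BoundedVariables.
Context (R : realType) (d : measure_display) (Omega : measurableType d).
Context (P : probability Omega R).
Implicit Types X Y : Omega -> R.

Definition bounded_rv X :=
  measurable_fun setT X /\ exists M, forall w, `|X w| <= M.

Lemma bounded_rv_cst c : bounded_rv (fun=> c).
Proof. by split; [exact: measurable_cst | exists `|c|]. Qed.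

Lemma bounded_rvM X Y : bounded_rv X -> bounded_rv Y ->
  bounded_rv (fun w => X w * Y w).
Proof.
move=> [mX [a Xa]] [mY [b Yb]]; split; first exact: measurable_funM.
by exists (a * b) => w; rewrite normrM ler_pM.
Qed.

Lemma bounded_rvD X Y : bounded_rv X -> bounded_rv Y ->
  bounded_rv (fun w => X w + Y w).
Proof.
move=> [mX [a Xa]] [mY [b Yb]]; split; first exact: measurable_funD.
by exists (a + b) => w; rewrite (le_trans (ler_normD _ _)) ?lerD.
Qed.

Lemma bounded_rv_prod (I : Type) (r : seq I) (Q : pred I) (X : I -> Omega -> R) :
  (forall i, bounded_rv (X i)) -> bounded_rv (fun w => \prod_(i <- r | Q i) X i w).
Proof.
move=> bX; elim: r => [|i r IH].
  by under eq_fun do rewrite big_nil; exact: bounded_rv_cst.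
under eq_fun do rewrite big_cons; case: (Q i) => //; exact: bounded_rvM.
Qed.

Lemma bounded_rv_integrable X : bounded_rv X -> P.-integrable setT (EFin \o X).
Proof.
move=> [mX [M XM]]; apply: measurable_bounded_integrable => //.
  exact: (le_lt_trans (probability_le1 P measurableT) (ltry 1)).
exists M; split; first exact: num_real.
by move=> x Mx w _; exact: le_trans (XM w) (ltW Mx).
Qed.

Definition mean X : R := fine ('E_P[X])%E.

Lemma meanE X : mean X = \int[P]_w X w.
Proof. by rewrite /mean unlock. Qed.

Lemma mean_linear (I : Type) (r : seq I) (c : I -> R) (X : I -> Omega -> R) :
  (forall i, bounded_rv (X i)) ->
  mean (fun w => \sum_(i <- r) c i * X i w) = \sum_(i <- r) c i * mean (X i).
Proof.
move=> bX.
have bs s : bounded_rv (fun w => \sum_(i <- s) c i * X i w).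
  elim: s => [|i s IH].
    by under eq_fun do rewrite big_nil; exact: bounded_rv_cst.
  under eq_fun do rewrite big_cons; apply: bounded_rvD => //.
  exact: (bounded_rvM (bounded_rv_cst (c i))).
elim: r => [|i r IH].
  under eq_fun do rewrite big_nil.
  by rewrite big_nil meanE Rintegral_cst //= mul0r.
under eq_fun do rewrite big_cons.
rewrite big_cons -IH !meanE -RintegralZl //; last exact: bounded_rv_integrable.
rewrite -RintegralD //; apply: bounded_rv_integrable => //.
exact: (bounded_rvM (bounded_rv_cst (c i))).
Qed.

Lemma Cexpectation_linear (I : Type) (r : seq I) (c : I -> R[i]) (X : I -> Omega -> R) :
  (forall i, bounded_rv (X i)) ->
  Cexpectation P (fun w => \sum_(i <- r) c i * (X i w)%:C) =
  \sum_(i <- r) c i * (mean (X i))%:C.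
Proof.
move=> bX; rewrite /Cexpectation -!/(mean _).
(* The coefficients are complex but the variables are real, so real and imaginary parts reduce the
   claim to [mean_linear]. *)
have mulE (z : R[i]) (x : R) : z * x%:C = (complex.Re z * x) +i* (complex.Im z * x).
  by case: z => a b; rewrite /GRing.mul /=; congr (_ +i* _); rewrite !mulr0 ?subr0 ?add0r.
have sumE (F G : I -> R) : \sum_(i <- r) (F i +i* G i) =
    (\sum_(i <- r) F i) +i* (\sum_(i <- r) G i).
  by elim: r => [|i r' IH]; rewrite ?big_nil // !big_cons IH.
under [X in mean X +i* _]eq_fun => w do (under eq_bigr do rewrite mulE; rewrite sumE /=).
under [X in _ +i* mean X]eq_fun => w do (under eq_bigr do rewrite mulE; rewrite sumE /=).
rewrite !mean_linear // -sumE.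
by apply: eq_bigr => i _; rewrite mulE.
Qed.

End BoundedVariables.

(** * Borel structure on matrices and bounds on orthogonal entries *)

Section BorelMatrices.
Context (R : realType) (N : nat).
Implicit Types (V M : 'M[R]_N).

Lemma measurable_entry i j :
  measurable_fun setT (fun M : borel_mx R N => (M : 'M[R]_N) i j).
Proof.
apply: (measurability _ (RGenOpens.measurableE R)).
move=> _ [_ [a [b ->] <-]]; rewrite setTI; apply: sub_sigma_algebra.
move: (@coord_continuous R N N i j) => /continuousP; apply; exact: interval_open.
Qed.

(** Neighbourhoods of a matrix are given entrywise, and each entry of the product is a finite sum of
    multiples of coordinates. *)
Lemma continuous_mulmx V : continuous (mulmx V : 'M[R]_N -> 'M[R]_N).
Proof.
move=> M.
have FF : Filter (nbhs (M : 'M[R]_N)) by exact: nbhs_filter.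
have FM : Filter (mulmx V @ (M : 'M[R]_N)) by exact: fmap_filter.
move=> P [W WN WP].
have : \forall M' \near M, forall i j, W i j ((V *m M') i j).
  apply: (@filter_forall _ _ _ _ FF) => i; apply: (@filter_forall _ _ _ _ FF) => j.
  apply: (@filterS _ _ FF [set M' : 'M[R]_N | W i j (\sum_k V i k * M' k j)]).
    by move=> M' /=; rewrite mxE.
  have : \sum_k V i k * (M' : 'M[R]_N) k j @[M' --> M] --> \sum_k V i k * M k j.
    apply: (@cvg_big R^o _ +%R 0) => [|k _]; first exact: add_continuous.
    by apply: cvgMl_tmp; exact: coord_continuous.
  by apply; have := WN i j; rewrite mxE.
by apply: (@filterS _ _ FF) => M' b; apply: WP.
Qed.

Lemma measurable_mulmx V :
  measurable_fun setT (mulmx V : borel_mx R N -> borel_mx R N).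
Proof.
apply: (measurability ([set B : set 'M[R]_N | open B] : set (set (borel_mx R N))) erefl).
move=> _ [B oB <-]; rewrite setTI; apply: sub_sigma_algebra.
by move: (@continuous_mulmx V) => /continuousP; apply.
Qed.

Lemma orthogonal_entry_le1 V i j : orthogonal_mx V -> `|V i j| <= 1.
Proof.
move=> /matrixP/(_ i i); rewrite !mxE eqxx (bigD1 j) //= mxE => V1.
rewrite -(@expr_le1 _ 2) // real_normK ?num_real //.
rewrite -[leRHS](V1 : _ = 1) expr2 lerDl sumr_ge0 //.
by move=> k _; rewrite mxE -expr2 sqr_ge0.
Qed.

End BorelMatrices.

Section HaarMoments.
Context (R : realType) (N : nat) (d : measure_display) (Omega : measurableType d).
Context (P : probability Omega R) (U : Omega -> 'M[R]_N).
Hypothesis hU : haar_distributed P U.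
Context (n : nat) (H : pred 'I_n).
Implicit Types (i j c : {ffun 'I_n -> 'I_N}) (V : 'M[R]_N).

Definition mask V h : 'M[R]_N := if H h then V else 1%:M.

Definition moment i j := mean P (fun w => \prod_h mask (U w) h (i h) (j h)).

Let bounded_mask (Y : Omega -> 'M[R]_N) i j :
  measurable_fun setT (Y : Omega -> borel_mx R N) ->
  (forall w, orthogonal_mx (Y w)) ->
  bounded_rv (fun w => \prod_h mask (Y w) h (i h) (j h)).
Proof.
move=> mY oY; apply: bounded_rv_prod => h; rewrite /mask.
case: (H h); last exact: bounded_rv_cst.
split; last by exists 1 => w; exact: orthogonal_entry_le1.
exact: (measurableT_comp (@measurable_entry R N (i h) (j h)) mY).
Qed.

Lemma bounded_moment i j : bounded_rv (fun w => \prod_h mask (U w) h (i h) (j h)).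
Proof. by case: hU => mU oU _; exact: bounded_mask. Qed.

Lemma mask_mulmx V W h : mask (V *m W) h = mask V h *m mask W h.
Proof. by rewrite /mask; case: (H h); rewrite ?mulmx1. Qed.

(** Replacing [U] by [V *m U] preserves the law; expanding the entries of the product over the
    middle index [c] gives the formula. *)
Lemma moment_invariant V i j : orthogonal_mx V ->
  moment i j = \sum_(c : {ffun 'I_n -> 'I_N}) (\prod_h mask V h (i h) (c h)) * moment c j.
Proof.
move=> oV; case: (hU) => mU oU invU.
pose f (M : borel_mx R N) := \prod_h mask M h (i h) (j h).
have mf : measurable_fun setT f.
  apply: measurable_prod => h _; rewrite /mask; case: (H h); last exact: measurable_cst.
  exact: measurable_entry.
have mVU : measurable_fun setT ((fun w => V *m U w) : Omega -> borel_mx R N).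
  exact: (measurableT_comp (measurable_mulmx V) mU).
have oVU w : orthogonal_mx (V *m U w).
  by rewrite /orthogonal_mx trmx_mul mulmxA -(mulmxA V) oU mulmx1.
(* Haar invariance is an equality of laws, so both means are rewritten as integrals of [f] against
   pushforward measures. *)
have transfer (Y : Omega -> borel_mx R N) : measurable_fun setT Y ->
    (forall w, orthogonal_mx (Y w)) ->
    (\int[pushforward P Y]_M (f M)%:E = \int[P]_w (f (Y w))%:E)%E.
  move=> mY oY; rewrite (@integral_pushforward _ _ _ _ _ Y) //.
    exact/measurable_EFinP.
  exact/bounded_rv_integrable/bounded_mask.
transitivity (mean P (fun w => f (V *m U w))).
  rewrite /moment /mean unlock -!transfer //; congr fine.
  by apply: eq_measure_integral => B mB _; exact: esym (invU V B oV mB).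
transitivity (mean P (fun w => \sum_(c : {ffun 'I_n -> 'I_N})
    (\prod_h mask V h (i h) (c h)) * \prod_h mask (U w) h (c h) (j h))).
  congr (mean P _); apply/funext => w; rewrite /f.
  under eq_bigr do rewrite mask_mulmx mxE.
  by rewrite bigA_distr_bigA; apply: eq_bigr => c _; rewrite big_split.
rewrite mean_linear // => c; exact: bounded_moment.
Qed.

End HaarMoments.

(** * First-order coefficients and identity of polynomials *)

Section FirstOrder.
Context (S : comNzRingType).

Lemma coef1M (p q : {poly S}) : (p * q)`_1 = p`_0 * q`_1 + p`_1 * q`_0.
Proof. by rewrite coefM !big_ord_recl big_ord0 addr0. Qed.

(** This is the Leibniz rule at 0. *)
Lemma coef1_prod (I : eqType) (r : seq I) (p : I -> {poly S}) : uniq r ->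
  (\prod_(i <- r) p i)`_1 =
  \sum_(i <- r) (p i)`_1 * \prod_(j <- r | j != i) (p j)`_0.
Proof.
elim: r => [|k r IH] /=; first by rewrite !big_nil coef1.
move=> /andP[kr ur]; rewrite !big_cons coef1M IH // coef0_prod eqxx /= addrC.
congr (_ + _).
  congr (_ * _); rewrite [LHS]big_seq [RHS]big_seq_cond; apply: eq_bigl => j.
  by case: (boolP (j \in r)) => //= jr; apply/esym; apply: contraNneq kr => <-.
rewrite mulr_sumr [LHS]big_seq [RHS]big_seq; apply: eq_bigr => i ir.
rewrite big_cons mulrCA; case: eqVneq => [ki|//].
by move: kr; rewrite ki ir.
Qed.

End FirstOrder.

(** A nonzero difference would have too many roots, the natural numbers being distinct in
    characteristic zero. *)
Lemma eq_poly_horner (F : numFieldType) (p q : {poly F}) :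
  (forall x, p.[x] = q.[x]) -> p = q.
Proof.
move=> pq; apply/eqP; rewrite -subr_eq0; apply/negP => /negP pq0.
pose s := [seq k%:R : F | k <- iota 0 (size (p - q))].
have rs : all (root (p - q)) s.
  by apply/allP => x _; rewrite /root !hornerE pq subrr.
have us : uniq s.
  by rewrite map_inj_uniq ?iota_uniq // => x y /eqP; rewrite eqr_nat => /eqP.
by have := max_poly_roots pq0 rs us; rewrite size_map size_iota ltnn.
Qed.

(** * Rational parametrization of plane rotations *)

Section PlaneRotation.
Context (R : realFieldType) (N : nat) (a b : 'I_N).
Hypothesis ab : a != b.

(** [Q] is the projection on the plane and [E] the generator of its rotations: [E] squares to [- Q]
    and commutes with [Q]. *)
Let Q : 'M[R]_N := delta_mx a a + delta_mx b b.
Let E : 'M[R]_N := delta_mx a b - delta_mx b a.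

Let QQ : Q *m Q = Q.
Proof.
rewrite /Q mulmxDl !mulmxDr !mul_delta_mx !mul_delta_mx_cond.
by rewrite (negPf ab) eq_sym (negPf ab) !mulr0n addr0 add0r.
Qed.

Let EE : E *m E = - Q.
Proof.
rewrite /E /Q mulmxBl !mulmxBr !mul_delta_mx !mul_delta_mx_cond.
by rewrite (negPf ab) eq_sym (negPf ab) !mulr0n sub0r subr0 opprD addrC.
Qed.

Let QE : Q *m E = E.
Proof.
rewrite /E /Q mulmxDl !mulmxBr !mul_delta_mx !mul_delta_mx_cond.
by rewrite (negPf ab) eq_sym (negPf ab) !mulr0n sub0r subr0.
Qed.

Let EQ : E *m Q = E.
Proof.
rewrite /E /Q mulmxBl !mulmxDr !mul_delta_mx !mul_delta_mx_cond.
by rewrite (negPf ab) eq_sym (negPf ab) !mulr0n add0r addr0.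
Qed.

Let Et : E^T = - E.
Proof. by rewrite /E linearB /= !trmx_delta opprB. Qed.

Let Qt : Q^T = Q.
Proof. by rewrite /Q linearD /= !trmx_delta. Qed.

(* The rotation of the plane (a, b) with cosine (1 - t^2) / (1 + t^2) and sine
   2 t / (1 + t^2); clearing the denominator makes its entries polynomial. *)
Definition plane_rotation (t : R) : 'M[R]_N :=
  1%:M - (2 * t ^+ 2 / (1 + t ^+ 2)) *: Q + (2 * t / (1 + t ^+ 2)) *: E.

(** With $x = 1 - \cos$ and $s = \sin$, the product is $1 + (x^2 - 2x + s^2) Q$, and this
    coefficient vanishes. *)
Lemma plane_rotation_orthogonal t :
  plane_rotation t *m (plane_rotation t)^T = 1%:M.
Proof.
have t0 : 1 + t ^+ 2 != 0 by rewrite gt_eqF // ltr_wpDr ?sqr_ge0.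
rewrite /plane_rotation; set x := 2 * t ^+ 2 / _; set s := 2 * t / _.
clearbody Q E.
have -> : (1%:M - x *: Q + s *: E)^T = 1%:M - x *: Q - s *: E.
  by rewrite !linearD /= linearN !linearZ /= tr_scalar_mx Et Qt scalerN.
rewrite !mulmxBr !mulmxDl !mulNmx !mul1mx !mulmx1 -!scalemxAl -!scalemxAr.
rewrite QQ QE EQ EE; apply/matrixP => u k; rewrite !mxE /x /s.
by move: (u == k)%:R (Q u k) (E u k) => *; field.
Qed.

Definition plane_rotation_poly (u k : 'I_N) : {poly R} :=
  (u == k)%:R%:P * (1 + 'X^2) - (2 * Q u k)%:P * 'X^2 + (2 * E u k)%:P * 'X.

Lemma horner_plane_rotation_poly t u k :
  (plane_rotation_poly u k).[t] = (1 + t ^+ 2) * plane_rotation t u k.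
Proof.
have t0 : 1 + t ^+ 2 != 0 by rewrite gt_eqF // ltr_wpDr ?sqr_ge0.
rewrite /plane_rotation_poly /plane_rotation -[X in X + 'X^2]polyC1.
rewrite !(hornerD, hornerN, hornerM, hornerC, hornerXn, hornerX).
clearbody Q E; rewrite !mxE.
by move: (u == k)%:R (Q u k) (E u k) => *; field.
Qed.

Lemma coef0_plane_rotation_poly u k : (plane_rotation_poly u k)`_0 = (u == k)%:R.
Proof.
rewrite /plane_rotation_poly !coefD coefN !coefCM !coefD !coefXn coefX coef1 /=.
by rewrite !(mulr0, addr0, mulr1, subr0).
Qed.

(** The first-order direction is [2 E], an antisymmetric matrix; the factor $1 + t^2$ only acts from
    order two on. *)
Lemma coef1_plane_rotation_poly u k :
  (plane_rotation_poly u k)`_1 =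
  2 * (((u == a) && (k == b))%:R - ((u == b) && (k == a))%:R).
Proof.
rewrite /plane_rotation_poly !coefD coefN !coefCM !coefD !coefXn coefX coef1 /=.
have -> : E u k = ((u == a) && (k == b))%:R - ((u == b) && (k == a))%:R.
  by rewrite /E !mxE.
by move: (_%:R - _) (Q u k) (u == k)%:R => *; ring.
Qed.

End PlaneRotation.

Section RotationInvariance.
Context (R : realType) (N : nat) (d : measure_display) (Omega : measurableType d).
Context (P : probability Omega R) (U : Omega -> 'M[R]_N).
Hypothesis hU : haar_distributed P U.
Context (n : nat) (H : pred 'I_n).
Implicit Types (i j c : {ffun 'I_n -> 'I_N}).

Let mom := @moment R N d Omega P U n H.

(** Half-edges outside [H] also carry the factor $1 + t^2$, so that the total factor is its [n]-th
    power whatever [H] is. *)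
Let mask_poly a b h (u k : 'I_N) : {poly R} :=
  if H h then plane_rotation_poly R a b u k else (u == k)%:R%:P * (1 + 'X^2).

Let mask_poly0 a b h u k : (mask_poly a b h u k)`_0 = (u == k)%:R.
Proof.
rewrite /mask_poly; case: (H h); first by rewrite coef0_plane_rotation_poly.
by rewrite coefCM coefD coef1 coefXn /= addr0 mulr1.
Qed.

Let mask_poly1 a b h u k : (mask_poly a b h u k)`_1 =
  if H h then 2 * (((u == a) && (k == b))%:R - ((u == b) && (k == a))%:R) else 0.
Proof.
rewrite /mask_poly; case: (H h); first by rewrite coef1_plane_rotation_poly.
by rewrite coefCM coefD coef1 coefXn /= addr0 mulr0.
Qed.

Let sum_upd (h : 'I_n) (x y : 'I_N) i (F : {ffun 'I_n -> 'I_N} -> R) :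
  \sum_(c : {ffun 'I_n -> 'I_N}) ((i h == x) && (c h == y))%:R *
     (\prod_(k | k != h) (i k == c k)%:R) * F c =
  (i h == x)%:R * F (upd i h y).
Proof.
rewrite (bigD1 (upd i h y)) //= upd_eq eqxx andbT big1 ?mulr1; last first.
  by move=> k kh; rewrite upd_neq // eqxx.
rewrite big1 ?addr0 // => c cy.
have [chy|] := eqVneq (c h) y; last by rewrite andbF !mul0r.
have /existsP[k /andP[kh ick]] : [exists k, (k != h) && (i k != c k)].
  apply: contraNT cy; rewrite negb_exists => /forallP cE.
  apply/eqP/ffunP => k; rewrite ffunE; case: eqVneq => [->//|kh].
  by have := cE k; rewrite kh /= negbK => /eqP.
by rewrite (bigD1 k) //= (negPf ick) mul0r mulr0 mul0r.
Qed.

(* First order in t of the invariance under the rotation of the plane (x, y):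
   this is the invariance under the Lie algebra of O(N). *)
Lemma moment_rot_inv x y i j :
  \sum_(h | H h && (i h == x)) mom (upd i h y) j =
  \sum_(h | H h && (i h == y)) mom (upd i h x) j.
Proof.
have [->//|xy] := eqVneq x y.
have powE (S : pzSemiRingType) (z : S) : z ^+ n = \prod_(h < n) z.
  by rewrite prodr_const card_ord.
(* The identity of [moment_invariant], multiplied by $(1 + t^2)^n$, holds for every $t$ and
   therefore between polynomials. *)
have polyE : (1 + 'X^2) ^+ n * (mom i j)%:P =
    \sum_(c : {ffun 'I_n -> 'I_N}) (\prod_h mask_poly x y h (i h) (c h)) * (mom c j)%:P.
  apply: eq_poly_horner => t.
  rewrite hornerM horner_exp hornerC horner_sum.
  have := @moment_invariant R N d Omega P U hU n H (plane_rotation x y t) i j.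
  move=> /(_ (plane_rotation_orthogonal xy t)); rewrite -/mom => ->.
  rewrite mulr_sumr; apply: eq_bigr => c _; rewrite hornerM hornerC mulrA; congr (_ * _).
  rewrite horner_prod -[X in X + 'X^2]polyC1 hornerD hornerC hornerXn.
  rewrite powE -big_split; apply: eq_bigr => h _ /=.
  rewrite /mask /mask_poly; case: (H h); first by rewrite horner_plane_rotation_poly.
  by rewrite -[X in X + 'X^2]polyC1 hornerM hornerD !hornerC hornerXn mxE mulrC.
(* The coefficients of order one are compared; the left-hand side is a polynomial in $t^2$. *)
have : ((1 + 'X^2) ^+ n * (mom i j)%:P)`_1 = 0.
  rewrite coefMC powE coef1_prod ?index_enum_uniq // big1 ?mul0r // => k _.
  by rewrite coefD coef1 coefXn addr0 mul0r.
rewrite polyE coef_sum.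
under eq_bigr => c _.
  rewrite coefMC coef1_prod ?index_enum_uniq //.
  under eq_bigr => h _ do under eq_bigr => k _ do rewrite mask_poly0.
  rewrite mulr_suml.
  over.
rewrite exchange_big /=.
under eq_bigr => h _.
  rewrite (_ : \sum_c _ = if H h then
    2 * ((i h == x)%:R * mom (upd i h y) j - (i h == y)%:R * mom (upd i h x) j) else 0).
    over.
  under eq_bigr do rewrite mask_poly1.
  case: (H h); last by rewrite big1 // => c _; rewrite !mul0r.
  rewrite -!(sum_upd _ _ _ _ (fun c => mom c j)) -sumrB mulr_sumr.
  by apply: eq_bigr => c _; rewrite -!mulrA -mulrBl.
rewrite -big_mkcond -mulr_sumr sumrB /= => /eqP.
rewrite mulf_eq0 pnatr_eq0 /= subr_eq0 => /eqP sumE.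
transitivity (\sum_(h | H h) (i h == x)%:R * mom (upd i h y) j).
  rewrite big_mkcondr; apply: eq_bigr => h _.
  by case: eqP; rewrite ?mul1r ?mul0r.
rewrite sumE [RHS]big_mkcondr; apply: eq_bigr => h _.
by case: eqP; rewrite ?mul1r ?mul0r.
Qed.

End RotationInvariance.

(** * Boundedness from the loop equations *)

Section Matchings.
Context (n : nat) (H : pred 'I_n).
Implicit Types (a : {perm 'I_n}) (e f h : 'I_n).

Definition matching a := [forall h, (a (a h) == h) && (a h != h)].

Lemma matchingP a :
  reflect (involutive a /\ forall h, a h != h) (matching a).
Proof.
apply: (iffP forallP) => [am|[aK aF] h]; last by rewrite aK eqxx aF.
by split=> h; have /andP[/eqP] := am h.
Qed.

Lemma matching_rematch a e f : matching a -> matching (rematch a e f).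
Proof.
move=> /matchingP[aK aF]; apply/matchingP; split; first exact: rematchK.
move=> h; rewrite /rematch; set t := tperm _ _.
by rewrite -(permKV t h) permJ (inj_eq perm_inj) aF.
Qed.

(** Each chromatic edge is represented by its end in [H], so the cardinal of this set counts these
    edges. *)
Definition chromatic_set a := [set h | H h && ~~ H (a h)]%SET.

Lemma chromatic_uniq a e f : matching a ->
  e \in chromatic_set a -> f \in chromatic_set a -> f != e ->
  uniq [:: e; a e; f; a f] /\ uniq [:: e; a e; a f; a (a f)].
Proof.
move=> /matchingP[aK aF]; rewrite !inE => /andP[He Hae] /andP[Hf Haf] fe.
have ne x y : H x -> ~~ H y -> x != y by move=> Hx; apply: contraNneq => <-.
rewrite /= !inE !negb_or aK !andbT (eq_sym (a f) f) (eq_sym (a e) f).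
rewrite (ne e (a e)) // (ne e (a f)) // (ne f (a f)) // (ne f (a e)) //.
by rewrite (inj_eq perm_inj) (eq_sym e f) fe.
Qed.

(** The new edges [{e, f}] and [{a e, a f}] each join two half-edges of the same kind, so [e] and
    [f] leave the set. *)
Lemma card_chromatic_plus a e f : matching a ->
  e \in chromatic_set a -> f \in chromatic_set a -> f != e ->
  (#|chromatic_set (rematch a e f)| < #|chromatic_set a|)%N.
Proof.
move=> am ec fc fe; have [u _] := chromatic_uniq am ec fc fe.
have /matchingP[aK _] := am; have [r1 r2 r3] := rematchE aK u.
have rK := rematchK e f aK.
move: (ec) (fc); rewrite !inE => /andP[He Hae] /andP[Hf Haf].
apply/proper_card/properP; split; last first.
  by exists e => //; rewrite inE r1 Hf andbF.
apply/fintype.subsetP => h; rewrite !inE.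
have [->|he] := eqVneq h e; first by rewrite r1 Hf andbF.
have [->|hae] := eqVneq h (a e); first by rewrite (negPf Hae).
have [->|hf] := eqVneq h f; first by rewrite -(canRL rK r1) He andbF.
have [->|haf] := eqVneq h (a f); first by rewrite (negPf Haf).
by rewrite r3 // !inE !negb_or he hae hf haf.
Qed.

(** The new edges [{e, a f}] and [{f, a e}] are again chromatic, with the same ends in [H]. *)
Lemma chromatic_set_minus a e f : matching a ->
  e \in chromatic_set a -> f \in chromatic_set a -> f != e ->
  chromatic_set (rematch a e (a f)) = chromatic_set a.
Proof.
move=> am ec fc fe; have [_ u] := chromatic_uniq am ec fc fe.
have /matchingP[aK _] := am; have [r1 r2 r3] := rematchE aK u.
have rK := rematchK e (a f) aK; rewrite aK in r2 r3.
move: (ec) (fc); rewrite !inE => /andP[He Hae] /andP[Hf Haf].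
apply/setP => h; rewrite !inE.
have [->|he] := eqVneq h e; first by rewrite r1 Haf Hae.
have [->|hae] := eqVneq h (a e); first by rewrite (negPf Hae).
have [->|hf] := eqVneq h f; first by rewrite -(canRL rK r2) Haf Hae.
have [->|haf] := eqVneq h (a f); first by rewrite (negPf Haf).
by rewrite r3 // !inE !negb_or he hae hf haf.
Qed.

End Matchings.

(** * Bounds by induction on the number of chromatic edges *)

Section Bootstrap.
Context (R : realType).

(** A threshold is allowed because the absorption in [bootstrap] takes [N] large. *)
Definition ultimately_bounded (F : nat -> R) :=
  exists c N0, forall N, (N0 <= N)%N -> F N <= c.

Lemma ultimately_bounded_finite (I : finType) (Q : pred I) (F : nat -> I -> R) :
  (forall i, Q i -> ultimately_bounded (F^~ i)) ->
  exists2 c, 0 <= c & exists N0, forall N i, (N0 <= N)%N -> Q i -> F N i <= c.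
Proof.
move=> bF.
have /choice[g gP] i : exists p : R * nat, Q i -> forall N, (p.2 <= N)%N -> F N i <= p.1.
  case: (boolP (Q i)) => [/bF[c [N0 cP]]|_]; last by exists (0, 0%N).
  by exists (c, N0).
exists (\sum_i `|(g i).1|); first by apply: sumr_ge0.
exists (\max_i (g i).2) => N i Ni Qi; apply: le_trans (gP i Qi N _) _.
  by apply: leq_trans Ni; exact: leq_bigmax.
rewrite (bigD1 i) //= (le_trans (ler_norm _)) // lerDl.
by apply: sumr_ge0.
Qed.

(** In the application [gam] counts components and [T N a] is the modulus of the expectation for the
    map with edges [a]; [T_loop] is then the loop equation after the triangle inequality. *)
Context (n : nat) (H : pred 'I_n) (gam : {perm 'I_n} -> nat).
Context (T : nat -> {perm 'I_n} -> R).
Implicit Types (a : {perm 'I_n}) (e f h : 'I_n) (N : nat).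
Hypothesis gam_le : forall a, (gam a <= n)%N.
Hypothesis gam_rematch : forall a e f, matching a ->
  uniq [:: e; a e; f; a f] -> (gam (rematch a e f) <= (gam a).+1)%N.
Hypothesis T_ge0 : forall N a, 0 <= T N a.
Hypothesis T_loop : forall N a e, (0 < N)%N -> matching a ->
  e \in chromatic_set H a ->
  N%:R ^+ (gam a).+1 * T N a <= N%:R ^+ gam a * T N a +
    \sum_(f | (f != e) && (f \in chromatic_set H a))
      (N%:R ^+ gam (rematch a e f) * T N (rematch a e f) +
       N%:R ^+ gam (rematch a e (a f)) * T N (rematch a e (a f))).
Hypothesis T_base : forall a, matching a -> chromatic_set H a = finset.set0 ->
  exists c, forall N, (0 < N)%N -> T N a <= c.

(* The terms with the sign + have fewer chromatic edges and are bounded by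
   induction. A term with the sign - is multiplied by 1/N unless it has one more
   component, so that after weighting T N a by D ^ gam a with D large, all of
   these terms are absorbed in the left-hand side. *)
Lemma bootstrap a : matching a -> ultimately_bounded (T^~ a).
Proof.
have [k] := ubnP #|chromatic_set H a|; elim: k a => // k IH a.
rewrite ltnS leq_eqVlt => /orP[/eqP ka am|]; last exact: IH.
have [a0|[e0 e0a]] := set_0Vmem (chromatic_set H a).
  by have [c cP] := T_base am a0; exists c, 1%N.
pose Q b := matching b && (#|chromatic_set H b| < k)%N.
have [c c0 [N1 cP]] : exists2 c, 0 <= c & exists N0, forall N b,
    (N0 <= N)%N -> Q b -> T N b <= c.
  by apply: ultimately_bounded_finite => b /andP[bm bk]; exact: IH.
(* This [D] bounds the terms that gain a component by [N W / 4] in total; the threshold [N2] does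
   the same for the other terms in [W]. *)
pose D : nat := (4 * n.+1)%N.
have D0 : (0 < D)%N by [].
have DR0 : (0 : R) < D%:R by rewrite ltr0n.
have D1 : (1 : R) <= D%:R by rewrite ler1n.
pose Q' b := matching b && (#|chromatic_set H b| == k).
have Q'a : Q' a by rewrite /Q' am ka /=.
pose N2 := (4 * n.+1 * D ^ n)%N.
exists (2 * (D%:R ^+ n * (n%:R * c))), (maxn N1 (maxn N2 1)) => N.
rewrite !geq_max => /and3P[N1N N2N N0].
have NR0 : (0 : R) < N%:R by rewrite ltr0n.
have NN : 4 * n.+1%:R * D%:R ^+ n <= N%:R :> R.
  by rewrite -natrX -!natrM ler_nat.
have nD : n%:R / D%:R <= 4^-1 :> R.
  by rewrite ler_pdivrMr // /D natrM mulrA mulVf // mul1r ler_nat.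
clearbody D N2.
pose W b := D%:R ^+ gam b * T N b.
(* The loop equation is applied at a maximizer of [W] among the matchings with [k] chromatic edges,
   a class preserved by the switches with sign -. *)
pose b := [arg max_(b > a | Q' b) W b]%O.
have [Q'b Wmax] : Q' b /\ forall b', Q' b' -> W b' <= W b.
  by rewrite /b; case: Order.TotalTheory.arg_maxP => // b' Q'b' max; split.
have W_ge0 b' : 0 <= W b' by rewrite mulr_ge0 // exprn_ge0.
have TW b' : Q' b' -> T N b' <= W b.
  move=> Qb'; apply: le_trans (Wmax b' Qb').
  by rewrite ler_peMl // exprn_ege1.
suff Wb : W b <= 2 * (D%:R ^+ n * (n%:R * c)) by exact: le_trans (TW a Q'a) Wb.
move: (Q'b) => /andP[bm /eqP bk].
(* [b] has as many chromatic edges as [a], hence at least one. *)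
have [b0|[e eb]] := set_0Vmem (chromatic_set H b).
  by move: (cards0 'I_n); rewrite -b0 bk -ka => /eqP; rewrite cards_eq0 => /eqP a0;
     move: e0a; rewrite a0 inE.
have N_loop : N%:R * W b <= W b + N%:R * (D%:R ^+ n * (n%:R * c)) +
     N%:R * (n%:R / D%:R * W b) + D%:R ^+ n * (n%:R * W b).
  have NX k1 k2 : (k1 <= k2)%N -> (N%:R : R) ^+ k1 <= N%:R ^+ k2.
    by move=> k12; rewrite ler_weXn2l // ler1n.
  have DX : D%:R ^+ gam b <= D%:R ^+ n :> R by rewrite ler_weXn2l.
  have AC1 (x y z t : R) : x * (y * z * t) = y * (z * (x * t)) by ring.
  have AC2 (x y z t u v w : R) : x * (y * (z * (t * u) + (z * v * w + t * w))) =
      y * (z * (t * (x * u)) + (z * (x * v * w) + t * (x * w))) by ring.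
  have plus f : (f != e) && (f \in chromatic_set H b) ->
      D%:R ^+ gam b * (N%:R ^+ gam (rematch b e f) * T N (rematch b e f)) <=
      N%:R ^+ gam b * (N%:R * (D%:R ^+ n * c)).
    move=> /andP[fe fb]; have [u _] := chromatic_uniq bm eb fb fe.
    rewrite [leRHS]mulrA -exprSr [leRHS]mulrCA; apply: ler_pM => //.
      by rewrite mulr_ge0 ?exprn_ge0.
    apply: ler_pM => //; first exact/NX/gam_rematch.
    apply: cP => //; rewrite /Q matching_rematch // -bk.
    exact: card_chromatic_plus.
  have minus f : (f != e) && (f \in chromatic_set H b) ->
      D%:R ^+ gam b * (N%:R ^+ gam (rematch b e (b f)) * T N (rematch b e (b f))) <=
      N%:R ^+ gam b * (N%:R / D%:R * W b + D%:R ^+ n * W b).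
    move=> /andP[fe fb]; have [_ u] := chromatic_uniq bm eb fb fe.
    set b' := rematch b e (b f).
    have Qb' : Q' b'.
      by rewrite /Q' matching_rematch // chromatic_set_minus // bk /=.
    (* When a component is created, the extra factor [N] comes with [1 / D], because the weight of
       [b'] contains one more power of [D]. *)
    have := gam_rematch bm u; rewrite -/b' leq_eqVlt => /orP[/eqP gb'|].
      have -> : D%:R ^+ gam b * (N%:R ^+ gam b' * T N b') =
                N%:R ^+ gam b * (N%:R * (D%:R ^+ gam b * T N b')).
        by rewrite gb' [N%:R ^+ _.+1]exprSr AC1.
      rewrite ler_pM2l ?exprn_gt0 //.
      apply: (@le_trans _ _ (N%:R / D%:R * W b)); last first.
        by rewrite lerDl mulr_ge0 // exprn_ge0.
      rewrite -[leRHS]mulrA ler_pM2l // ler_pdivlMl // mulrA -exprS -gb'.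
      exact: Wmax.
    rewrite ltnS => gb'; rewrite mulrCA; apply: ler_pM.
    - by rewrite exprn_ge0.
    - by rewrite mulr_ge0 ?exprn_ge0.
    - exact: NX.
    apply: (@le_trans _ _ (D%:R ^+ n * W b)).
      by apply: ler_pM => //; exact: TW.
    by rewrite lerDr mulr_ge0 // divr_ge0.
  have := T_loop N0 bm eb.
  rewrite -(@ler_pM2l _ (D%:R ^+ gam b)) ?exprn_gt0 //.
  rewrite mulrDr mulr_sumr => Tb.
  rewrite -(@ler_pM2l _ (N%:R ^+ gam b)) ?exprn_gt0 //.
  have -> : N%:R ^+ gam b * (N%:R * W b) = D%:R ^+ gam b * (N%:R ^+ (gam b).+1 * T N b).
    by rewrite /W [N%:R ^+ _.+1]exprSr AC1.
  apply: le_trans Tb _.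
  rewrite -!addrA mulrDr; apply: lerD; first by rewrite mulrCA.
  pose B := N%:R * (D%:R ^+ n * c) + (N%:R / D%:R * W b + D%:R ^+ n * W b).
  have B0 : 0 <= N%:R ^+ gam b * B.
    rewrite mulr_ge0 ?exprn_ge0 // /B !addr_ge0 // ?mulr_ge0 ?divr_ge0 ?exprn_ge0 //.
  apply: (@le_trans _ _ (\sum_(f < n) N%:R ^+ gam b * B)).
    rewrite [leLHS]big_mkcond; apply: ler_sum => f _; case: ifP => // fP.
    by rewrite mulrDr /B mulrDr; apply: lerD; [exact: plus | exact: minus].
  rewrite sumr_const card_ord -[leLHS]mulr_natl /B le_eqVlt.
  by apply/orP; left; rewrite AC2.
(* Two quarters of [N W b] are absorbed on the left; the remaining half accounts for the factor 2 in
   the bound. *)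
have NB := N_loop; set B := D%:R ^+ n * (n%:R * c) in NB *.
have h1 : N%:R * (n%:R / D%:R * W b) <= N%:R * (4^-1 * W b).
  by rewrite ler_pM2l // ler_wpM2r.
have h2 : W b + D%:R ^+ n * (n%:R * W b) <= N%:R * (4^-1 * W b).
  apply: (@le_trans _ _ (D%:R ^+ n * n.+1%:R * W b)).
    rewrite -addn1 natrD mulrDr mulrDl mulr1 addrC lerD // -?mulrA //.
    by rewrite ler_peMl // exprn_ege1.
  rewrite mulrA ler_wpM2r // ler_pdivlMr //.
  by rewrite mulrC mulrA mulrAC.
have h3 : N%:R * W b <= N%:R * (2 * B) by lra.
by rewrite ler_pM2l in h3.
Qed.

End Bootstrap.

(** * Maps without chromatic edges *)

Section OrthogonalCancellation.
Context (R : realType) (n N : nat) (a : {perm 'I_n}).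
Hypothesis am : matching a.

Lemma porbit_matching h : porbit a h = [set h; a h]%SET.
Proof.
have /matchingP[aK _] := am.
apply/setP => x; rewrite !inE; apply/porbitP/orP => [[k ->]|[]/eqP ->].
- elim: k => [|k IH]; first by rewrite expg0 perm1; left.
  by rewrite expgSr permM; case: IH => /eqP ->; rewrite ?aK; [right | left].
- by exists 0%N; rewrite expg0 perm1.
- by exists 1%N; rewrite expg1.
Qed.

Lemma big_matching (T : Type) (idx : T) (op : Monoid.com_law idx) (F : 'I_n -> T) :
  \big[op/idx]_h F h =
  \big[op/idx]_(c : cycle_of a) op (F (cycle_least c)) (F (a (cycle_least c))).
Proof.
have /matchingP[_ aF] := am.
rewrite (big_cycle_iter a); apply: eq_bigr => c _.
have -> : val c = porbit a (cycle_least c) by rewrite -[LHS](congr1 val (cycle_leastK c)).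
rewrite porbit_matching cards2 eq_sym aF !big_ord_recl big_ord0 /=.
by rewrite Monoid.mulm1.
Qed.

(* Since [W h] and [W (a h)] are the same orthogonal matrix, summing over the
   common index of h and a h contracts them to the identity. *)
Lemma sum_matched_orthogonal (W : 'I_n -> 'M[R]_N) (j : {ffun 'I_n -> 'I_N}) :
  (forall h, W (a h) = W h) -> (forall h, orthogonal_mx (W h)) ->
  \sum_(i | matched a i) \prod_h W h (i h) (j h) = (matched a j)%:R.
Proof.
move=> Wa oW; have /matchingP[aK _] := am.
have := matched_sum_cycles a (fun i : {ffun 'I_n -> 'I_N} => \prod_h W h (i h) (j h)).
rewrite /matched_sum => ->.
transitivity (\prod_(c : cycle_of a) \sum_(x < N)
    W (cycle_least c) x (j (cycle_least c)) *
    W (cycle_least c) x (j (a (cycle_least c)))).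
  rewrite bigA_distr_bigA; apply: eq_bigr => f _; rewrite big_matching.
  by apply: eq_bigr => c _; rewrite !ffunE cycle_at_step cycle_leastK Wa.
(* The summed index is the row, so the orthonormality of the columns is used; [mulmx1C] deduces it
   from that of the rows. *)
have sumW h : \sum_(x < N) W h x (j h) * W h x (j (a h)) = (j h == j (a h))%:R.
  have /mulmx1C/matrixP/(_ (j h) (j (a h))) := oW h; rewrite !mxE => <-.
  by apply: eq_bigr => x _; rewrite mxE.
under eq_bigr do rewrite sumW.
have [/matchedP jm|] := boolP (matched a j).
  by rewrite big1 // => c _; rewrite jm eqxx.
rewrite /matched negb_forall => /existsP[h jh].
rewrite (bigD1 (cycle_at a h)) //=; set h0 := cycle_least _.
suff /negPf -> : j h0 != j (a h0) by rewrite mul0r.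
have : h0 \in porbit a h := cycle_least_in (cycle_at a h).
by rewrite porbit_matching !inE => /orP[]/eqP ->; rewrite ?aK // eq_sym.
Qed.

End OrthogonalCancellation.

(** * Restriction of a map to an invariant set of half-edges *)

Section Submaps.
Context (n k : nat) (phi : 'I_k -> 'I_n).
(** Monotonicity makes least half-edges correspond, so that tensors are read from the same starting
    point in the submap. *)
Hypothesis phi_mono : {mono phi : x y / (x <= y)%N}.

Lemma phi_inj : injective phi.
Proof.
move=> x y xy; apply/val_inj/eqP; rewrite eqn_leq -!phi_mono.
by rewrite xy leqnn.
Qed.

Lemma sub_perm (s : {perm 'I_n}) :
  (forall x, exists y, s (phi x) = phi y) ->
  exists s1 : {perm 'I_k}, forall x, phi (s1 x) = s (phi x).
Proof.
move=> /choice[f fP].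
have fI : injective f by move=> x y fxy; apply/phi_inj/(@perm_inj _ s); rewrite !fP fxy.
by exists (perm fI) => x; rewrite permE fP.
Qed.

Lemma porbit_phi (s : {perm 'I_n}) (s1 : {perm 'I_k}) x :
  (forall x, phi (s1 x) = s (phi x)) ->
  porbit s (phi x) = [set phi y | y in porbit s1 x]%SET.
Proof.
move=> sE; have sX l : (s ^+ l)%g (phi x) = phi ((s1 ^+ l)%g x).
  by elim: l => [|l IH]; rewrite ?expg0 ?perm1 // !expgSr !permM IH sE.
apply/setP => h; apply/porbitP/imsetP => [[l ->]|[y /porbitP[l ->] ->]].
  by exists ((s1 ^+ l)%g x); rewrite ?sX ?mem_porbit.
by exists l; rewrite sX.
Qed.

Lemma least_phi (s : {perm 'I_n}) (s1 : {perm 'I_k}) x :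
  (forall x, phi (s1 x) = s (phi x)) -> least s (phi x) = least s1 x.
Proof.
move=> sE; apply/forall_inP/forall_inP => [xmin y yx|xmin h].
  by rewrite -phi_mono xmin // (porbit_phi _ sE) imset_f.
by rewrite (porbit_phi _ sE) => /imsetP[y yx ->]; rewrite phi_mono xmin.
Qed.

Lemma submap (I I1 : Type) (ell : I -> nat) (ell1 : I1 -> nat) (inj : I1 -> I)
    (m : imap ell n) :
  (forall l, ell (inj l) = ell1 l) ->
  (forall x, exists l, hlabel m (phi x) = inj l) ->
  (forall x, exists y, vperm m (phi x) = phi y) ->
  (forall x, exists y, eperm m (phi x) = phi y) ->
  exists m1 : imap ell1 k,
    [/\ forall x, phi (vperm m1 x) = vperm m (phi x),
        forall x, phi (eperm m1 x) = eperm m (phi x) &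
        forall x, least (vperm m1) x -> inj (hlabel m1 x) = hlabel m (phi x)].
Proof.
move=> ellE /choice[lab labE] /sub_perm[p1 p1E] /sub_perm[a1 a1E].
have a1K : involutive a1 by move=> x; apply/phi_inj; rewrite !a1E epermK.
pose c := CMap p1 a1K.
(* [lab] chooses a label at each half-edge, possibly varying along a vertex; the one at the least
   half-edge is kept. *)
have labP (v : vertex c) : ell1 (lab (cycle_least v)) = deg v.
  rewrite -ellE -labE labelP /deg /=.
  rewrite -[RHS](card_imset _ phi_inj) (porbit_phi _ p1E).
  have -> // : porbit p1 (cycle_least v) = sval v.
  by rewrite -[RHS](congr1 val (cycle_leastK v)).
exists (IMap labP); split=> // x xl.
by rewrite labE /hlabel /= cycle_at_leastK.
Qed.

End Submaps.

Section WeightLeast.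
Context (R : realType) (I : Type) (ell : I -> nat) (n N : nat).

Lemma weight_least (m : imap ell n) (A : tensor_family R ell N) i :
  weight m A i = \prod_(h | least (vperm m) h)
    A (hlabel m h) [tuple i (iter k (vperm m) h) | k < ell (hlabel m h)].
Proof.
rewrite /weight big_cycle_least; apply: eq_bigr => h hl.
congr (A _ _); apply: eq_from_tnth => k; rewrite !tnth_mktuple /bdry.
by rewrite cycle_at_leastK.
Qed.

End WeightLeast.

Section WeightSubmap.
Context (R : realType) (I : Type) (ell : I -> nat) (n N : nat).

(** The tensors are compared on tuples read off a function on [nat], since tuples of lengths
    [ell (inj l)] and [ell1 l] have different types. *)
Lemma weight_submap (k : nat) (phi : 'I_k -> 'I_n) (I1 : Type) (ell1 : I1 -> nat)
    (m1 : imap ell1 k) (A1 : tensor_family R ell1 N)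
    (p : {perm 'I_n}) (lab : 'I_n -> I) (A : tensor_family R ell N) (inj : I1 -> I)
    (i : {ffun 'I_n -> 'I_N}) :
  {mono phi : x y / (x <= y)%N} ->
  (forall l (t : nat -> 'I_N),
     A (inj l) [tuple t k | k < ell (inj l)] = A1 l [tuple t k | k < ell1 l]) ->
  (forall x, phi (vperm m1 x) = p (phi x)) ->
  (forall x, least (vperm m1) x -> inj (hlabel m1 x) = lab (phi x)) ->
  \prod_(h | least p h && (h \in codom phi))
    A (lab h) [tuple i (iter k p h) | k < ell (lab h)] =
  weight m1 A1 [ffun x => i (phi x)].
Proof.
move=> phi_mono AE pE labE; rewrite weight_least.
have phiI := phi_inj phi_mono.
rewrite (reindex_omap phi (fun h => [pick x | phi x == h])) /=; last first.
  move=> h /andP[_ /codomP[x ->]]; case: pickP => [y /eqP /= -> //|/(_ x)].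
  by rewrite eqxx.
apply: eq_big => [x|x].
  rewrite (least_phi phi_mono _ pE) codom_f andbT.
  case: pickP => [y /eqP/phiI ->|/(_ x)]; rewrite eqxx //.
  by rewrite andbT.
rewrite (least_phi phi_mono _ pE) => /andP[/andP[xl _] _].
rewrite -labE // (AE _ (fun k => i (iter k p (phi x)))); congr (A1 _ _).
apply: eq_from_tnth => l; rewrite !tnth_mktuple ffunE; congr (i _).
by elim: (l : nat) => [|l' IH] //=; rewrite pE IH.
Qed.

End WeightSubmap.

Section SplitSum.
Context (S : comPzRingType) (n k1 k0 N : nat).
Context (phi1 : 'I_k1 -> 'I_n) (phi0 : 'I_k0 -> 'I_n).
Hypothesis cov : forall h, (exists x, h = phi1 x) \/ (exists x, h = phi0 x).
Hypothesis k10 : (k1 + k0 = n)%N.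

(** Restricting an index to the two parts is injective by [cov], and bijective since [k10] equates
    the cardinals. *)
Lemma matched_sum_split (a : {perm 'I_n}) (a1 : {perm 'I_k1}) (a0 : {perm 'I_k0})
    (F1 : {ffun 'I_k1 -> 'I_N} -> S) (F0 : {ffun 'I_k0 -> 'I_N} -> S) :
  (forall x, phi1 (a1 x) = a (phi1 x)) -> (forall x, phi0 (a0 x) = a (phi0 x)) ->
  matched_sum (fun i : {ffun 'I_n -> 'I_N} =>
    F1 [ffun x => i (phi1 x)] * F0 [ffun x => i (phi0 x)]) a =
  matched_sum F1 a1 * matched_sum F0 a0.
Proof.
move=> a1E a0E; rewrite /matched_sum big_distrlr /= pair_big /=.
pose J (i : {ffun 'I_n -> 'I_N}) := ([ffun x => i (phi1 x)], [ffun x => i (phi0 x)]).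
have Jinj : injective J.
  move=> i i' [/ffunP e1 /ffunP e0]; apply/ffunP => h.
  by case: (cov h) => -[x ->]; [have := e1 x | have := e0 x]; rewrite !ffunE.
rewrite (reindex J) /=; last first.
  apply: onW_bij; apply: inj_card_bij Jinj _.
  by rewrite card_prod !card_ffun !card_ord -expnD k10.
apply: eq_bigl => i; apply/matchedP/andP => [im|[/matchedP i1 /matchedP i0] h].
  by split; apply/matchedP => x; rewrite !ffunE ?a1E ?a0E im.
case: (cov h) => -[x ->].
  by have := i1 x; rewrite !ffunE a1E.
by have := i0 x; rewrite !ffunE a0E.
Qed.

End SplitSum.

(** The enumeration of [K] is a subsequence of that of all ordinals, hence increasing. *)
Lemma enum_val_leq n (K : {set 'I_n}) :
  {mono (@enum_val _ (mem K)) : x y / (x <= y)%N >-> (x <= y)%N}.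
Proof.
have srt : sorted ltn [seq val x | x <- enum K].
  rewrite /enum_mem -enumT; apply: (subseq_sorted ltn_trans) (iota_ltn_sorted 0 n).
  by rewrite -(val_enum_ord n) map_subseq ?filter_subseq.
have homo (x y : 'I_#|K|) : (x < y)%N -> (enum_val x < enum_val y)%N.
  move=> xy; have x0 : 'I_n := enum_val x; rewrite !(enum_val_nth x0).
  have sz (z : 'I_#|K|) : (z : nat) \in [pred k | (k < size [seq val x | x <- enum K])%N].
    by rewrite inE size_map -cardE.
  have := sorted_ltn_nth ltn_trans 0%N srt x y (sz x) (sz y) xy.
  by rewrite !(nth_map x0) -?cardE.
move=> x y; case: (ltngtP x y) => [xy|yx|/val_inj ->]; last by rewrite !leqnn.
  by rewrite ltnW ?homo.
by apply/negbTE; rewrite -ltnNge homo.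
Qed.

Section MixedTraces.
Context (R : realType) (I0 I1 : Type) (ell0 : I0 -> nat) (ell1 : I1 -> nat) (n : nat).
Implicit Types (m : imap (sum_order ell0 ell1) n).

Definition rotated m : pred 'I_n := fun h => in_right (hlabel m h).

Lemma hlabel_vperm m h : hlabel m (vperm m h) = hlabel m h.
Proof. by rewrite /hlabel /vertex_at cycle_at_step. Qed.

(** Without chromatic edges both ends of an edge carry the same matrix, and the sum over [i] is
    contracted by [sum_matched_orthogonal]. *)
Lemma trace_rotate m N (A0 : tensor_family R ell0 N) (A1 : tensor_family R ell1 N)
    (U : 'M[R]_N) :
  matching (eperm m) -> chromatic_set (rotated m) (eperm m) = finset.set0 ->
  orthogonal_mx U ->
  trace_action m (sum_family A0 (rotate_family A1 U)) =
  trace_action m (sum_family A0 A1).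
Proof.
move=> am achr oU; rewrite !trace_actionE; congr (_ * _); rewrite /matched_sum.
under eq_bigr do rewrite weight_rotate.
rewrite exchange_big /= [RHS]big_mkcond; apply: eq_bigr => j _.
rewrite -mulr_sumr.
have -> : \sum_(i | matched (eperm m) i) \prod_h (rotated_at m U h (i h) (j h))%:C =
    (\sum_(i | matched (eperm m) i) \prod_h rotated_at m U h (i h) (j h))%:C.
  by rewrite rmorph_sum; apply: eq_bigr => i _; rewrite rmorph_prod.
rewrite (@sum_matched_orthogonal R n N (eperm m) am (rotated_at m U) j) //.
- by case: ifP => _; rewrite ?mulr1 ?mulr0.
- have Hle h : rotated m h -> rotated m (eperm m h).
    move=> Hh; apply/negP => /negP Hah.
    by move/setP: achr => /(_ h); rewrite !inE Hh Hah.
  move=> h; rewrite /rotated_at; congr (if _ then _ else _).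
  by apply/idP/idP => /Hle //; rewrite /rotated epermK.
- move=> h; rewrite /rotated_at; case: ifP => // _.
  by rewrite /orthogonal_mx trmx1 mulmx1.
Qed.

(** The rotated half-edges are stable under both permutations, so the map splits into an [I1]-map
    and an [I0]-map. Its trace is the product of their traces times a power of [N] whose exponent is
    nonpositive by [leq_ncompD]. *)
Lemma bounded_unmixed m (A0 : forall N, tensor_family R ell0 N)
    (A1 : forall N, tensor_family R ell1 N) :
  bounded_traces A0 -> bounded_traces A1 ->
  matching (eperm m) -> chromatic_set (rotated m) (eperm m) = finset.set0 ->
  exists c : R, forall N, (0 < N)%N ->
    `|trace_action m (sum_family (A0 N) (A1 N))| <= c%:C.
Proof.
move=> bA0 bA1 am achr; have /matchingP[aK aF] := am.
have Hle h : rotated m h -> rotated m (eperm m h).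
  move=> Hh; apply/negP => /negP Hah.
  by move/setP: achr => /(_ h); rewrite !inE Hh Hah.
have Ha h : rotated m (eperm m h) = rotated m h.
  by apply/idP/idP => /Hle //; rewrite /rotated epermK.
have Hp h : rotated m (vperm m h) = rotated m h by rewrite /rotated hlabel_vperm.
pose K := [set h | rotated m h]%SET.
pose phi1 : 'I_#|K| -> 'I_n := @enum_val _ (mem K).
pose phi0 : 'I_#|~: K| -> 'I_n := @enum_val _ (mem (~: K)).
have H1 x : rotated m (phi1 x) by have := enum_valP x; rewrite inE.
have H0 x : ~~ rotated m (phi0 x) by have := enum_valP x; rewrite !inE.
have phi1E h : rotated m h -> exists x, h = phi1 x.
  by move=> Hh; have hK : h \in K by [rewrite inE]; exists (enum_rank_in hK h);
     rewrite /phi1 enum_rankK_in.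
have phi0E h : ~~ rotated m h -> exists x, h = phi0 x.
  by move=> Hh; have hK : h \in ~: K by [rewrite !inE]; exists (enum_rank_in hK h);
     rewrite /phi0 enum_rankK_in.
have mono1 : {mono phi1 : x y / (x <= y)%N} := @enum_val_leq n K.
have mono0 : {mono phi0 : x y / (x <= y)%N} := @enum_val_leq n (~: K).
have [m1 [p1 a1 l1]] : exists m1 : imap ell1 #|K|,
    [/\ forall x, phi1 (vperm m1 x) = vperm m (phi1 x),
        forall x, phi1 (eperm m1 x) = eperm m (phi1 x) &
        forall x, least (vperm m1) x -> inr (hlabel m1 x) = hlabel m (phi1 x)].
  apply: submap => // x.
  - by have := H1 x; rewrite /rotated; case: (hlabel m _) => // l _; exists l.
  - by apply: phi1E; rewrite Hp.
  - by apply: phi1E; rewrite Ha.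
have [m0 [p0 a0 l0]] : exists m0 : imap ell0 #|~: K|,
    [/\ forall x, phi0 (vperm m0 x) = vperm m (phi0 x),
        forall x, phi0 (eperm m0 x) = eperm m (phi0 x) &
        forall x, least (vperm m0) x -> inl (hlabel m0 x) = hlabel m (phi0 x)].
  apply: submap => // x.
  - by have := H0 x; rewrite /rotated; case: (hlabel m _) => // l _; exists l.
  - by apply: phi0E; rewrite Hp.
  - by apply: phi0E; rewrite Ha.
have nb k (phi : 'I_k -> 'I_n) (c : cmap k) :
    (forall x, phi (eperm c x) = eperm m (phi x)) -> nboundary c = 0%N.
  move=> ac; apply: eq_card0 => x; rewrite inE; apply/negbTE.
  by apply/eqP => /(congr1 phi); rewrite ac; apply/eqP.
have [c1 c1P] := bA1 _ m1 (nb _ _ _ a1).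
have [c0 c0P] := bA0 _ m0 (nb _ _ _ a0).
exists (c1 * c0) => N N0.
have cov h : (exists x, h = phi1 x) \/ (exists x, h = phi0 x).
  by case: (boolP (rotated m h)) => Hh; [left; exact: phi1E | right; exact: phi0E].
have dis x y : phi1 x != phi0 y.
  by apply: contraTneq (H1 x) => ->; exact: H0.
have gam : (ncomp m1 + ncomp m0 <= ncomp m)%N.
  by apply: (leq_ncompD (phi_inj mono1) (phi_inj mono0)).
have wE i : weight m (sum_family (A0 N) (A1 N)) i =
    weight m1 (A1 N) [ffun x => i (phi1 x)] * weight m0 (A0 N) [ffun x => i (phi0 x)].
  rewrite weight_least (bigID (fun h => h \in codom phi1)) /=; congr (_ * _).
    exact: (weight_submap (inj := inr) _ mono1).
  rewrite (eq_bigl (fun h => least (vperm m) h && (h \in codom phi0))).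
    exact: (weight_submap (inj := inl) _ mono0).
  move=> h; congr (_ && _); case: (cov h) => -[x ->]; rewrite codom_f ?negbK.
    by apply/esym/negbTE/codomP => -[y xy]; have := dis x y; rewrite xy eqxx.
  by apply/codomP => -[y xy]; have := dis y x; rewrite xy eqxx.
have AC (S : comNzRingType) (x y z t u : S) :
    x * (y * t * (z * u)) = y * z * x * (t * u) by ring.
have NC : (N%:R : R[i]) != 0 by rewrite pnatr_eq0 -lt0n.
have SE (I : Type) (ell : I -> nat) k (c : imap ell k) (A : tensor_family R ell N) :
    matched_sum (weight c A) (eperm c) = N%:R ^+ ncomp c * trace_action c A.
  by rewrite trace_actionE mulVKf // expf_neq0.
have k10 : (#|K| + #|~: K| = n)%N by rewrite cardsC card_ord.
have -> : trace_action m (sum_family (A0 N) (A1 N)) =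
    N%:R ^+ (ncomp m1 + ncomp m0) / N%:R ^+ ncomp m *
    (trace_action m1 (A1 N) * trace_action m0 (A0 N)).
  have wS := matched_sum_split cov k10
    (weight m1 (A1 N)) (weight m0 (A0 N)) a1 a0.
  rewrite !SE /matched_sum in wS.
  rewrite trace_actionE exprD /matched_sum; under eq_bigr do rewrite wE.
  by rewrite wS AC.
move: (trace_action m1 _) (c1P N N0) (trace_action m0 _) (c0P N N0) => t1 b1 t0 b0.
rewrite rmorphM /= !normrM -[leRHS]mul1r; apply: ler_pM => //.
  rewrite normrV ?unitfE ?expf_neq0 // !normrX !normr_nat.
  rewrite ler_pdivrMr ?mul1r ?exprn_gt0 ?ltr0n //.
  by rewrite ler_weXn2l // ler1n.
exact: ler_pM.
Qed.

End MixedTraces.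

(** * The Schwinger-Dyson expansion *)

Section Modulus.
Context (R : realType).
Implicit Types x y z : R[i].

(** The norm on [R[i]] takes its values in [R[i]], whereas [bootstrap] works with real numbers. *)
Definition modulus z : R := complex.Re `|z|.

Lemma modulusE z : (modulus z)%:C = `|z|.
Proof. exact/RRe_real/normr_real. Qed.

Lemma modulus_ge0 z : 0 <= modulus z.
Proof. by rewrite -ler0c modulusE. Qed.

Lemma modulusB x y : modulus (x - y) <= modulus x + modulus y.
Proof. by rewrite -lecR rmorphD /= !modulusE ler_normB. Qed.

Lemma modulusD x y : modulus (x + y) <= modulus x + modulus y.
Proof. by rewrite -lecR rmorphD /= !modulusE ler_normD. Qed.

Lemma modulus_sum (I : finType) (Q : pred I) (F : I -> R[i]) :
  modulus (\sum_(i | Q i) F i) <= \sum_(i | Q i) modulus (F i).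
Proof.
rewrite -lecR rmorph_sum modulusE /=.
by under [leRHS]eq_bigr do rewrite modulusE; exact: ler_norm_sum.
Qed.

Lemma modulusM_nat k z : modulus (k%:R * z) = k%:R * modulus z.
Proof.
apply: (@complexI R); rewrite rmorphM /= !modulusE normrM normr_nat.
by rewrite rmorph_nat.
Qed.

End Modulus.

Section MixedExpectation.
Context (R : realType) (I0 I1 : Type) (ell0 : I0 -> nat) (ell1 : I1 -> nat) (n : nat).
Context (N : nat) (A0 : tensor_family R ell0 N) (A1 : tensor_family R ell1 N).
Context (d : measure_display) (Omega : measurableType d) (P : probability Omega R).
Context (U : Omega -> 'M[R]_N).
Hypothesis hU : haar_distributed P U.
Implicit Types (m : imap (sum_order ell0 ell1) n).

(** This is the function [g] of the loop equation: the expectation of the rotated weight, which does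
    not depend on the edges of [m]. *)
Definition mixed_weight m (i : {ffun 'I_n -> 'I_N}) : R[i] :=
  \sum_j weight m (sum_family A0 A1) j * (moment P U (rotated m) i j)%:C.

Lemma mixed_expectationE m :
  mixed_expectation A0 A1 P U m =
  (N%:R ^+ ncomp m)^-1 * matched_sum (mixed_weight m) (eperm m).
Proof.
rewrite /mixed_expectation.
pose r := [seq p : {ffun 'I_n -> 'I_N} * {ffun 'I_n -> 'I_N} <- index_enum _
            | matched (eperm m) p.1].
pose c (p : {ffun 'I_n -> 'I_N} * {ffun 'I_n -> 'I_N}) : R[i] :=
  (N%:R ^+ ncomp m)^-1 * weight m (sum_family A0 A1) p.2.
pose X (p : {ffun 'I_n -> 'I_N} * {ffun 'I_n -> 'I_N}) w :=
  \prod_h mask (rotated m) (U w) h (p.1 h) (p.2 h).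
transitivity (Cexpectation P (fun w => \sum_(p <- r) c p * (X p w)%:C)).
  congr (Cexpectation P _); apply/funext => w.
  rewrite trace_actionE /matched_sum big_filter.
  rewrite [X in _ * X](eq_bigr _ (fun i _ => weight_rotate m A0 A1 (U w) i)).
  rewrite pair_big_dep /= mulr_sumr; apply: eq_big => [p|p _]; first by rewrite andbT.
  by rewrite /c /X mulrA rmorph_prod.
rewrite Cexpectation_linear; last by move=> p; exact: (bounded_moment hU).
rewrite big_filter /matched_sum /mixed_weight pair_big_dep /= mulr_sumr.
by apply: eq_big => [p|p _]; rewrite ?andbT // mulrA.
Qed.

Lemma mixed_weight_rot_inv m (x y : 'I_N) (i : {ffun 'I_n -> 'I_N}) :
  \sum_(h | rotated m h && (i h == x)) mixed_weight m (upd i h y) =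
  \sum_(h | rotated m h && (i h == y)) mixed_weight m (upd i h x).
Proof.
rewrite /mixed_weight exchange_big [RHS]exchange_big /=; apply: eq_bigr => j _.
by rewrite -!mulr_sumr -!rmorph_sum /= (moment_rot_inv hU).
Qed.

End MixedExpectation.

Lemma Cexpectation_cst (R : realType) (d : measure_display) (Omega : measurableType d)
    (P : probability Omega R) (z : R[i]) : Cexpectation P (fun=> z) = z.
Proof.
rewrite /Cexpectation (expectation_cst P (complex.Re z)).
rewrite (expectation_cst P (complex.Im z)).
by case: z.
Qed.

Section Rewiring.
Context (R : realType) (I0 I1 : Type) (ell0 : I0 -> nat) (ell1 : I1 -> nat) (n : nat).
Context (A0 : forall N, tensor_family R ell0 N) (A1 : forall N, tensor_family R ell1 N).
Context (d : nat -> measure_display) (Omega : forall N, measurableType (d N)).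
Context (P : forall N, probability (Omega N) R) (U : forall N, Omega N -> 'M[R]_N).
Hypothesis hA0 : bounded_traces A0.
Hypothesis hA1 : bounded_traces A1.
Hypothesis hU : forall N, (0 < N)%N -> haar_distributed (P N) (@U N).
Context (m : imap (sum_order ell0 ell1) n).
Implicit Types (b : {perm 'I_n}) (e f : 'I_n) (N : nat).

Definition rewire b (bK : involutive b) : imap (sum_order ell0 ell1) n :=
  @IMap _ _ n (CMap (vperm m) bK) (@label _ _ n m) (@labelP _ _ n m).

(** No proof of involutivity is carried, so this function is defined on the whole finite type of
    permutations, over which the induction ranges. *)
Definition rewired_ncomp b : nat :=
  #|[set orbit 'P <<[set vperm m; b]>>%g h | h : 'I_n]%SET|.

Definition rewired_sum N b : R[i] :=
  matched_sum (mixed_weight (A0 N) (A1 N) (P N) (@U N) m) b.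

Definition rewired_modulus N b : R :=
  modulus (rewired_sum N b) / N%:R ^+ rewired_ncomp b.

Lemma rewired_sumE N b (bK : involutive b) : (0 < N)%N ->
  rewired_sum N b = (N ^ rewired_ncomp b)%:R *
    mixed_expectation (A0 N) (A1 N) (P N) (@U N) (rewire bK).
Proof.
move=> N0; rewrite (mixed_expectationE _ _ (hU N0)) natrX mulVKf //.
by rewrite expf_neq0 // pnatr_eq0 -lt0n.
Qed.

Lemma rewired_modulusE N b : (0 < N)%N ->
  N%:R ^+ rewired_ncomp b * rewired_modulus N b = modulus (rewired_sum N b).
Proof.
by move=> N0; rewrite mulrC divfK // expf_neq0 // pnatr_eq0 -lt0n.
Qed.

Lemma rewired_modulus_expectation N b (bK : involutive b) : (0 < N)%N ->
  rewired_modulus N b =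
  modulus (mixed_expectation (A0 N) (A1 N) (P N) (@U N) (rewire bK)).
Proof.
move=> N0; rewrite /rewired_modulus (rewired_sumE bK N0) modulusM_nat.
rewrite natrX mulrC mulKf //.
by rewrite expf_neq0 // pnatr_eq0 -lt0n.
Qed.

Lemma rewired_loop N b e : (0 < N)%N -> matching b ->
  e \in chromatic_set (rotated m) b ->
  N%:R * rewired_sum N b = rewired_sum N b +
    \sum_(f | (f != e) && (f \in chromatic_set (rotated m) b))
      (rewired_sum N (rematch b e f) - rewired_sum N (rematch b e (b f))).
Proof.
move=> N0 /matchingP[bK bF]; rewrite inE => /andP[He Hbe].
rewrite mulr_natl (loop_equation (mixed_weight_rot_inv (A0 N) (A1 N) (hU N0) m)
  bK bF He Hbe).
by congr (_ + _); apply: eq_bigl => f; rewrite !inE.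
Qed.

Lemma rewired_ncomp_rematch b e f : matching b -> uniq [:: e; b e; f; b f] ->
  (rewired_ncomp (rematch b e f) <= (rewired_ncomp b).+1)%N.
Proof.
by move=> /matchingP[bK _] u; exact: (@leq_ncomp_switch n (CMap (vperm m) bK)).
Qed.

Lemma rewired_bounded b : matching b -> ultimately_bounded (rewired_modulus^~ b).
Proof.
apply: (bootstrap (gam := rewired_ncomp) (H := rotated m)).
- by move=> c; rewrite -[leqRHS]card_ord leq_imset_card.
- exact: rewired_ncomp_rematch.
- by move=> N c; rewrite divr_ge0 ?modulus_ge0 ?exprn_ge0.
- move=> N c e N0 cm ec; rewrite exprS -mulrA rewired_modulusE //.
  rewrite -modulusM_nat (rewired_loop N0 cm ec) (le_trans (modulusD _ _)) // lerD2l.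
  apply: le_trans (modulus_sum _ _) _; apply: ler_sum => f _.
  by rewrite !rewired_modulusE // modulusB.
move=> c cm chr; have /matchingP[cK _] := cm.
have [k kP] := @bounded_unmixed _ _ _ _ _ _ (rewire cK) A0 A1 hA0 hA1 cm chr.
exists k => N N0; rewrite (rewired_modulus_expectation cK N0) -lecR modulusE.
have [_ oU _] := hU N0.
(* In the base case [U] disappears pointwise, which leaves the expectation of a constant. *)
rewrite /mixed_expectation; under eq_fun => w do rewrite trace_rotate //.
by rewrite Cexpectation_cst; exact: kP.
Qed.

End Rewiring.

Theorem proposition6 (R : realType) (I0 I1 : finType)
    (ell0 : I0 -> nat) (ell1 : I1 -> nat)
    (A0 : forall N : nat, tensor_family R ell0 N)
    (A1 : forall N : nat, tensor_family R ell1 N)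
    (d : nat -> measure_display)
    (Omega : forall N : nat, measurableType (d N))
    (P : forall N : nat, probability (Omega N) R)
    (U : forall N : nat, Omega N -> 'M[R]_N)
    (hA0 : bounded_traces A0) (hA1 : bounded_traces A1)
    (hU : forall N : nat, (0 < N)%N -> haar_distributed (P N) (U N))
    (n : nat) (m : imap (sum_order ell0 ell1) n) (e : 'I_n)
    (hm0 : nboundary m = 0%N) (hmc : connected_map m)
    (he : in_right (hlabel m e)) (hae : ~~ in_right (hlabel m (eperm m e))) :
  let E (N : nat) (m' : imap (sum_order ell0 ell1) n) : R[i] :=
    mixed_expectation (A0 N) (A1 N) (P N) (U N) m' in
  let chromatic (f : 'I_n) :=
    [&& f != e, in_right (hlabel m f) & ~~ in_right (hlabel m (eperm m f))] in
  let splits (m' : imap (sum_order ell0 ell1) n) :=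
    map_lt m' m && (ncomp m' == 2%N) in
  (fun N => E N m : R[i]^o) =
  (fun N =>
     \sum_(f < n | chromatic f && splits (iswitch_plus m e f))
        E N (iswitch_plus m e f)
     - \sum_(f < n | chromatic f && splits (iswitch_minus m e f))
        E N (iswitch_minus m e f))
  +O_\oo (fun N => N%:R^-1 : R[i]^o).

Proof.
move=> E chromatic splits.
set a := eperm m; pose H := rotated m.
have aF h : a h != h.
  by have := card0_eq hm0 h; rewrite !inE => /negbT.
have aK : involutive a := @epermK _ m.
have am : matching a by apply/matchingP.
have ea : e \in chromatic_set H a by rewrite inE; apply/andP.
have chE f : chromatic f = (f != e) && (f \in chromatic_set H a).
  by rewrite inE.
have ga : rewired_ncomp m a = 1%N by apply/eqP.
have uP f : chromatic f -> uniq [:: e; a e; f; a f] /\ uniq [:: e; a e; a f; a (a f)].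
  by rewrite chE => /andP[fe fa]; exact: (chromatic_uniq am ea fa fe).
have splitsE f : uniq [:: e; a e; f; a f] ->
    splits (iswitch m e f) = (rewired_ncomp m (rematch a e f) == 2%N).
  move=> u; rewrite /splits /map_lt eqxx rematch_is_switch //=.
  by rewrite (eqP hmc) andbb.
have splits_plus f : chromatic f ->
    splits (iswitch_plus m e f) = (rewired_ncomp m (rematch a e f) == 2%N).
  by case/uP => u _; exact: splitsE.
have splits_minus f : chromatic f ->
    splits (iswitch_minus m e f) = (rewired_ncomp m (rematch a e (a f)) == 2%N).
  by case/uP => _ u; exact: splitsE.
pose S N b := rewired_sum A0 A1 P U m N b.
pose T N b := rewired_modulus A0 A1 P U m N b.
(* After division by $N^2$, a switch with two components gives exactly its expectation, and any
   other switch gives [rest / N]. Thus [D N] is [N] times the error. *)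
pose rest N b : R[i] := if rewired_ncomp m b == 2%N then 0 else N%:R^-1 * S N b.
pose D N := E N m + \sum_(f | chromatic f)
  (rest N (rematch a e f) - rest N (rematch a e (a f))).
have ES N (b : {perm 'I_n}) (bK : involutive b) : (0 < N)%N -> 
    S N b = (N ^ rewired_ncomp m b)%:R * E N (rewire m bK).
  by move=> N0; exact: rewired_sumE.
have mE N : E N m = E N (rewire m aK) by [].
have diffE N : (0 < N)%N -> E N m -
    (\sum_(f < n | chromatic f && splits (iswitch_plus m e f))
         E N (iswitch_plus m e f)
     - \sum_(f < n | chromatic f && splits (iswitch_minus m e f))
         E N (iswitch_minus m e f)) = N%:R^-1 * D N.
  move=> N0; have NC : (N%:R : R[i]) != 0 by rewrite pnatr_eq0 -lt0n.
  have SE (b : {perm 'I_n}) (bK : involutive b) : N%:R^-1 * (N%:R^-1 * S N b) =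
      (if rewired_ncomp m b == 2%N then E N (rewire m bK) else 0) + N%:R^-1 * rest N b.
    rewrite /rest; case: eqP => [b2|_]; last by rewrite add0r.
    by rewrite (ES N b bK N0) b2 natrX mulr0 addr0 expr2 -mulrA !mulKf.
  have Sa : S N a = N%:R * E N m by rewrite (ES N a aK N0) ga expn1.
  (* One division by [N] comes from the left-hand side of the loop equation, the other from the
     single component of [m]. *)
  have := rewired_loop A0 A1 hU N0 am ea; rewrite -/(S N a).
  move=> /(congr1 (fun z => N%:R^-1 * (N%:R^-1 * z))).
  rewrite mulKf // {1}Sa mulKf // !mulrDr.
  rewrite {1}Sa mulKf // !mulr_sumr => {1}->.
  rewrite -addrA; congr (_ + _).
  rewrite [X in _ - (X - _)]big_mkcondr [X in _ - (_ - X)]big_mkcondr /=.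
  rewrite -sumrB; apply/eqP; rewrite subr_eq -big_split /=; apply/eqP.
  apply: eq_big => [f|f]; first by rewrite chE.
  rewrite -chE => fch; rewrite splits_plus // splits_minus // !mulrBr.
  rewrite (SE _ (rematchK e f aK)) (SE _ (rematchK e (a f) aK)).
  rewrite -/(rest _ _); set x := (if _ then _ else _); set y := (if _ then _ else _).
  by rewrite opprD addrACA addrC.
have [c c0 [N1 cP]] : exists2 c, 0 <= c & exists N0, forall N b,
    (N0 <= N)%N -> matching b -> T N b <= c.
  by apply: ultimately_bounded_finite => b bm; exact: (rewired_bounded hA0 hA1 hU).
have restP N b : (0 < N)%N -> (N1 <= N)%N -> matching b ->
    (rewired_ncomp m b <= 2)%N -> modulus (rest N b) <= c.
  move=> N0 N1N bm b2; rewrite /rest; case: eqP => [_|b2'].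
    by rewrite (_ : modulus 0 = 0) // /modulus normr0.
  (* With at most one component the modulus of the sum is at most [N c], which the factor [1 / N] in
     [rest] compensates. *)
  have b1 : (rewired_ncomp m b <= 1)%N by rewrite -ltnS ltn_neqAle b2 andbT; apply/eqP.
  have NR0 : (0 : R) < N%:R by rewrite ltr0n.
  rewrite -(@ler_pM2l _ N%:R) // -modulusM_nat mulVKf; last by rewrite pnatr_eq0 -lt0n.
  rewrite -(rewired_modulusE A0 A1 P U m b N0).
  apply: ler_pM; rewrite ?exprn_ge0 //; last exact: cP.
    by rewrite divr_ge0 ?modulus_ge0 ?exprn_ge0.
  by rewrite -[leRHS]expr1 ler_weXn2l // ler1n.
(* The constant counts [c] for [E N m] and [c + c] for the two switches at each [f]; the final 1
   makes it positive. *)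
apply/eqaddOP/bigO_exP; exists (c + \sum_(f < n) (c + c) + 1)%:C.
  rewrite -(rmorph0 (real_complex R)) ltcR ltr_wpDl // addr_ge0 // sumr_ge0 //.
  by move=> f _; rewrite addr_ge0.
exists (maxn N1 1) => // N /=; rewrite geq_max => /andP[N1N N0].
have -> : ((fun N => E N m : R[i]^o) - (fun N =>
     \sum_(f < n | chromatic f && splits (iswitch_plus m e f)) E N (iswitch_plus m e f)
     - \sum_(f < n | chromatic f && splits (iswitch_minus m e f))
         E N (iswitch_minus m e f)) : nat -> R[i]^o) N
   = N%:R^-1 * D N by exact: diffE.
rewrite normrM mulrC ler_wpM2r // -modulusE lecR.
apply: le_trans (_ : _ <= c + \sum_(f < n) (c + c)) _; last by rewrite lerDl.
rewrite /D (le_trans (modulusD _ _)) //; apply: lerD.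
  by rewrite mE -(rewired_modulus_expectation _ _ hU) //; exact: cP.
apply: le_trans (modulus_sum _ _) _; rewrite big_mkcond; apply: ler_sum => f _.
case: ifP => fch; last by rewrite addr_ge0.
have [u1 u2] := uP f fch.
apply: le_trans (modulusB _ _) _; apply: lerD; apply: restP => //;
  rewrite ?matching_rematch // -ga; exact: rewired_ncomp_rematch.
Qed.
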